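(* If $(X,\mathsf d,\mathfrak m)$ is an $RCD(K,\infty)$ metric measure space ($K\in\mathbb R$) with $\mathfrak m(X)=1$, and if $D=\operatorname{diam}(\operatorname{supp}\mathfrak m)$ is finite, then for all $\epsilon>0$ we can find $M=M(\epsilon,D,K)\ge1$ such that $$\int_{\{f\ge M\int_Xf\,d\mathfrak m\}}f\,d\mathfrak m\le\epsilon\Big(\int_Xf\,d\mathfrak m+\int_X|\nabla f|\,d\mathfrak m\Big)$$ for all nonnegative $f\in\mathrm{Lip}_b(X)$.
   Context: A metric measure space is $(X,\mathsf d,\mathfrak m)$ with $(X,\mathsf d)$ complete separable metric and $\mathfrak m$ a nonnegative Borel measure finite on bounded sets (no assumption $\operatorname{supp}\mathfrak m=X$). $\mathrm{Lip}_b(X)$: bounded Lipschitz functions. The constant $M$ depends only on $\epsilon,D,K$. Cheeger energy and gradients: $\mathrm{Lip}_af(x)=\lim_{r\downarrow0}\mathrm{Lip}(f|_{B_r(x)})$; $\mathsf{Ch}(f)=\inf\{\liminf_n\frac12\int\mathrm{Lip}_a^2(f_n)\,d\mathfrak m:\ f_n\in\mathrm{Lip}_b(X)\cap L^2,\ f_n\to f\text{ in }L^2\}$; $H^{1,2}(X,\mathsf d,\mathfrak m)=\{f\in L^2(X,\mathfrak m):\mathsf{Ch}(f)<\infty\}$. For $f\in H^{1,2}$, $|\nabla f|$ (minimal relaxed slope) is the element of least $L^2$ norm in the closed convex set of $g\in L^2$ with $g\ge$ some weak $L^2$ limit of $\mathrm{Lip}_a(f_n)$, $f_n\in\mathrm{Lip}_b(X)\cap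 L^2$, $f_n\to f$ in $L^2$. $RCD(K,\infty)$: $\mathfrak m(B_r(\bar x))\le c_1e^{c_2r^2}$ for all $r>0$ (some $\bar x,c_1,c_2$); $\mathsf{Ch}$ is quadratic; and the relative entropy $\mathrm{Ent}(\rho\mathfrak m)=\int\rho\log\rho\,d\mathfrak m$ ($+\infty$ off absolutely continuous measures) is $K$-convex on probability measures with finite second moment: for all $\mu_0,\mu_1$ with finite entropy some constant speed $W_2$-geodesic $\mu_t$ satisfies $\mathrm{Ent}(\mu_t)\le(1-t)\mathrm{Ent}(\mu_0)+t\,\mathrm{Ent}(\mu_1)-\frac K2t(1-t)W_2^2(\mu_0,\mu_1)$. *)

(* Defs.v *)
From HB Require Import structures.
From mathcomp Require Import all_boot all_order all_algebra.
From mathcomp Require Import all_classical all_reals all_analysis.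

Set Implicit Arguments.
Unset Strict Implicit.
Unset Printing Implicit Defensive.

Import Order.TTheory GRing.Theory Num.Theory.
Import numFieldTopology.Exports numFieldNormedType.Exports.

Local Open Scope classical_set_scope.
Local Open Scope ring_scope.

(* Like every completeType or measurableType, these spaces carry a
   distinguished point; the only content of this is that they are nonempty,
   which every space of positive total mass is. *)
#[short(type="completeMetricType")]
HB.structure Definition CompleteMetric (R : numDomainType) :=
  { T of Metric R T & Complete T }.

Definition separable (T : topologicalType) : Prop :=
  exists2 S : set T, countable S & dense S.

Notation borel T := (g_sigma_algebraType (@open T)).

Section metric.
Context {R : realType} {X : completeMetricType R}.
Implicit Types (A : set X) (f : X -> R) (x : X).

(* [-oo] for the empty set *)
Definition diam A : \bar R :=
  ereal_sup [set r | exists x y, [/\ A x, A y & r = (mdist x y)%:E]].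

(* The pairs [x = y] contribute [0 / 0 = 0]: the constant of a nonempty set is
   nonnegative, and it is [0] on a singleton. *)
Definition lip_const f A : \bar R :=
  ereal_sup [set r | exists x y,
    [/\ A x, A y & r = (`|f x - f y| / mdist x y)%:E]].

Definition Lip_b f : Prop :=
  (exists L, forall x y, `|f x - f y| <= L * mdist x y) /\
  (exists C, forall x, `|f x| <= C).

Definition asym_lip f x : \bar R := lim (lip_const f (ball x r) @[r --> 0^'+]).

End metric.

Section metric_measure.
Context {R : realType} {X : completeMetricType R}.
Variable m : {measure set (borel X) -> \bar R}.
Implicit Types (f g h : X -> R) (u : nat -> X -> R).
Local Open Scope ereal_scope.

Definition metric_measure_space : Prop :=
  separable X /\
  forall B : set (borel X), measurable B ->
    (exists (x : X) (r : R), B `<=` ball x r) -> m B < +oo.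

Definition msupp : set X := [set x | forall r : R, (0 < r)%R -> 0 < m (ball x r)].

Definition L2 f : Prop := (f : borel X -> R) \in Lfun m 2%:E.

Definition cvg_L2 u f : Prop :=
  'N[m]_2%:E[EFin \o (u n \- f)%R] @[n --> \oo] --> 0.

(* weak convergence in [L^2], for [u n] and [h] in [L^2] *)
Definition wcvg_L2 u h : Prop :=
  forall phi, L2 phi ->
    \int[m]_x (u n x * phi x)%:E @[n --> \oo] --> \int[m]_x (h x * phi x)%:E.

Definition lip_approx f u : Prop :=
  (forall n, Lip_b (u n) /\ L2 (u n)) /\ cvg_L2 u f.

Definition Ch f : \bar R :=
  ereal_inf [set limn_einf (fun n => (2^-1)%:E * \int[m]_x (asym_lip (u n) x ^+ 2))
            | u in lip_approx f].

(* [fine] is harmless: the slope of a Lipschitz function is finite. *)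
Definition relaxed_slope f g : Prop :=
  L2 g /\ exists u h,
    [/\ lip_approx f u,
        (forall n, L2 (fun x => fine (asym_lip (u n) x))), L2 h,
        wcvg_L2 (fun n x => fine (asym_lip (u n) x)) h
      & {ae m, forall x, (h x <= g x)%R}].

(* [|\nabla f|] is an m-a.e. class: this holds for all its representatives. *)
Definition min_relaxed_slope f g : Prop :=
  relaxed_slope f g /\
  forall g', relaxed_slope f g' ->
    'N[m]_2%:E[EFin \o g] <= 'N[m]_2%:E[EFin \o g'].

Definition Ch_quadratic : Prop :=
  forall f g, L2 f -> L2 g ->
    Ch (f \+ g)%R + Ch (f \- g)%R = 2%:E * Ch f + 2%:E * Ch g.

Definition density (mu : probability (borel X) R) (rho : X -> R) : Prop :=
  [/\ measurable_fun setT (rho : borel X -> R), (forall x, (0 <= rho x)%R)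
    & forall A : set (borel X), measurable A -> mu A = \int[m]_(x in A) (rho x)%:E].

(* Densities of [mu] agree a.e., so that the infimum is over at most one value,
   and over none, which gives [+oo], if [mu] is not absolutely continuous. *)
Definition Ent (mu : probability (borel X) R) : \bar R :=
  ereal_inf [set \int[m]_x (rho x * ln (rho x))%:E | rho in density mu].

End metric_measure.

Section wasserstein.
Context {R : realType} {X : completeMetricType R}.
Implicit Types mu nu : probability (borel X) R.
Local Open Scope ereal_scope.

Definition finite_second_moment mu : Prop :=
  exists x0 : X, \int[mu]_x ((mdist x x0) ^+ 2)%:E < +oo.

(* On a separable space the product of the Borel sigma-algebras is the Borel
   sigma-algebra of the product. *)
Definition coupling mu nu (p : probability (borel X * borel X)%type R) : Prop :=
  forall A : set (borel X), measurable A ->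
    p (A `*` setT) = mu A /\ p (setT `*` A) = nu A.

Definition W2 mu nu : \bar R :=
  sqrte (ereal_inf [set \int[p]_z ((mdist (z.1 : X) (z.2 : X)) ^+ 2)%:E
                   | p in coupling mu nu]).

(* Measures here are functions of all sets: endpoints are compared on
   Borel sets only. *)
Definition W2_geodesic mu0 mu1 (mu : R -> probability (borel X) R) : Prop :=
  [/\ (forall A, measurable A -> mu 0%R A = mu0 A /\ mu 1%R A = mu1 A),
      (forall t, (0 <= t <= 1)%R -> finite_second_moment (mu t))
    & forall s t, (0 <= s <= 1)%R -> (0 <= t <= 1)%R ->
        W2 (mu s) (mu t) = `|t - s|%:E * W2 mu0 mu1].

End wasserstein.

Section RCD.
Context {R : realType} {X : completeMetricType R}.
Variable m : {measure set (borel X) -> \bar R}.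
Local Open Scope ereal_scope.

Definition Ent_convex (K : R) : Prop :=
  forall mu0 mu1 : probability (borel X) R,
    finite_second_moment mu0 -> finite_second_moment mu1 ->
    Ent m mu0 \is a fin_num -> Ent m mu1 \is a fin_num ->
    exists2 mu, W2_geodesic mu0 mu1 mu &
      forall t : R, (0 <= t <= 1)%R ->
        Ent m (mu t) <= (1 - t)%:E * Ent m mu0 + t%:E * Ent m mu1
                        - (K / 2 * t * (1 - t))%:E * W2 mu0 mu1 ^+ 2.

Definition exp_growth : Prop :=
  exists (x0 : X) (c1 c2 : R), forall r : R, (0 < r)%R ->
    m (ball x0 r) <= (c1 * expR (c2 * r ^+ 2))%:E.

Definition RCD (K : R) : Prop :=
  [/\ metric_measure_space m, exp_growth, Ch_quadratic m & Ent_convex K].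

End RCD.

(* Main.v *)
From HB Require Import structures.
Require Import Defs.
From mathcomp Require Import all_boot all_order all_algebra.
From mathcomp Require Import all_classical all_reals all_analysis.
From mathcomp Require Import measurable_realfun ring lra.

Set Implicit Arguments.
Unset Strict Implicit.
Unset Printing Implicit Defensive.

Import Order.TTheory GRing.Theory Num.Theory.
Import numFieldTopology.Exports numFieldNormedType.Exports.

Local Open Scope classical_set_scope.
Local Open Scope ring_scope.

(** The statement is an entropy estimate. For a probability density [rho],
    Lipschitz and bounded away from [0], and for [m] carried by a set of
    diameter at most [D],

      Ent (rho m) <= D * \int |grad rho| dm + |K| * D^2 / 2      (lemma [L1_HWI]).

    With [rho] proportional to [f], the left side controls
    [log M * \int_{f >= M \int f} f], so that a large [log M], that is one of the
    order of [(D + |K| D^2 + 1) / eps], gives the theorem.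

    To prove the estimate, join [mu_0 = rho m] to [mu_1 = m], of entropy [0], by
    a geodesic [mu_t] along which the entropy is [K]-convex. Then

      t * Ent mu_0 <= Ent mu_0 - Ent mu_t + t * |K| * D^2 / 2.

    The Gibbs inequality [Ent mu_t >= \int log rho dmu_t], an equality at
    [t = 0], bounds [Ent mu_0 - Ent mu_t] by the integral of
    [log rho (x) - log rho (y)] against any coupling of [mu_0] and [mu_t], hence,
    to first order in [t], by that of [|grad rho| (x) / rho (x) * d (x, y)]. This
    is the proof of the HWI inequality of Otto and Villani, where the
    Cauchy-Schwarz inequality would come next. Here the displacement [d (x, y)]
    is bounded by [t * D] instead, and what remains is
    [t * D * \int |grad rho| / rho dmu_0 = t * D * \int |grad rho| dm]. No bound on
    the densities of the [mu_t] is involved, since the gradient is only seen by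
    [mu_0].

    That particles move by at most [t * D] in time [t] is clear for a measure on
    geodesic curves. It is obtained here from the distances
    [W2 (mu_0, mu_t) = t W] and [W2 (mu_t, mu_1) = (1 - t) W] alone
    ([near_optimal_displacement]): a near optimal coupling of [mu_0] and [mu_t]
    and one of [mu_t] and [mu_1] are glued along a partition of the space into
    countably many small cells ([glue_along]), and the equality case of
    [(a + b)^2 <= a^2 / t + b^2 / (1 - t)] forces [a] to be close to
    [t * (a + b)], up to an error controlled by the defect of optimality
    ([displacement_pointwise]).

    Since the minimal relaxed slope is defined by relaxation, all this is applied
    to Lipschitz functions [u] close to [f] in L^2, and local Lipschitz constants
    on balls of radius [r] play the role of [|grad u|]. On the fixed set
    [A = {f >= M \int f}], of measure at most [1 / M], the entropy is bounded below
    by [log M * \int_A rho - 1], which is linear in [rho]. This makes the passage to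
    the limit, [r -> 0] first and then [u -> f], immediate: the slopes converge
    weakly, and are tested against the constant [1]. *)

(** * Measures with a density *)

Section density_measure.
Local Open Scope ereal_scope.
Context {d} {T : measurableType d} {R : realType}.

(** The equality is one of measures, so that it can be eliminated: a theorem on
    measures of total mass [1] becomes one on probability measures. *)
Lemma measure_as_probability (m : {measure set T -> \bar R}) :
  m setT = 1 -> exists P : probability T R, (P : {measure set T -> \bar R}) = m.
Proof.
move: m => [m mP] m1.
pose mm : {measure set T -> \bar R} := Measure.Pack mP.
pose mx := Measure_isProbability.Build _ _ _ mm m1.
pose P : probability T R := HB.pack m mm mx.
by exists P.
Qed.

Section with_density.
Variables (mu : {measure set T -> \bar R}) (w : T -> R).

(** The proofs are arguments in order that the term determines its structure of
    measure. *)
Definition with_density (mw : measurable_fun setT w) (w0 : forall x, (0 <= w x)%R)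
  (A : set T) : \bar R := \int[mu]_(x in A) (w x)%:E.
Hypotheses (mw : measurable_fun setT w) (w0 : forall x, (0 <= w x)%R).
Local Notation nu := (with_density mw w0).

Let nu0 : nu set0 = 0. Proof. exact: integral_set0. Qed.
Let nu_ge0 A : 0 <= nu A.
Proof. by apply: integral_ge0 => x _; rewrite lee_fin. Qed.
Let nu_sigma : semi_sigma_additive nu.
Proof.
apply: semi_sigma_additive_nng_induced; first exact/measurable_EFinP.
by move=> x; rewrite lee_fin.
Qed.

HB.instance Definition _ := isMeasure.Build _ _ _ nu nu0 nu_ge0 nu_sigma.

Lemma density_probability : \int[mu]_x (w x)%:E = 1 ->
  exists P : probability T R, forall A, P A = \int[mu]_(x in A) (w x)%:E.
Proof.
move=> w1; have [P PE] := @measure_as_probability nu w1.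
by exists P => A; exact: (congr1 (fun m : {measure set T -> \bar R} => m A) PE).
Qed.

End with_density.

(** [w] is a version of the Radon-Nikodym derivative of [nu], for which the
    change of variables is known. *)
Lemma integral_density (mu nu : probability T R) (w : T -> R) (h : T -> \bar R) :
  measurable_fun setT w -> (forall x, (0 <= w x)%R) ->
  (forall A, measurable A -> nu A = \int[mu]_(x in A) (w x)%:E) ->
  measurable_fun setT h -> (forall x, 0 <= h x) ->
  \int[nu]_x h x = \int[mu]_x (h x * (w x)%:E).
Proof.
move=> mw w0 nuE mh h0.
have mEw : measurable_fun setT (EFin \o w) by exact/measurable_EFinP.
have numu : nu `<< mu.
  apply/null_content_dominatesP => A mA muA; rewrite nuE//.
  by apply: null_set_integral => //; exact: measurable_funTS.
rewrite -(Radon_Nikodym_SigmaFinite.change_of_variables numu)//.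
have iw : mu.-integrable setT (EFin \o w).
  apply/integrableP; split => //.
  under eq_integral do rewrite gee0_abs ?lee_fin//.
  by rewrite -nuE// probability_setT ltry.
have ae : ae_eq mu setT (EFin \o w) (Radon_Nikodym_SigmaFinite.f nu mu).
  apply: integral_ae_eq => //.
  - exact: (measurable_int _ (Radon_Nikodym_SigmaFinite.f_integrable numu)).
  - by move=> E _ mE; rewrite -Radon_Nikodym_SigmaFinite.f_integral// -nuE.
apply: ge0_ae_eq_integral => //.
- apply: emeasurable_funM => //.
  exact: (measurable_int _ (Radon_Nikodym_SigmaFinite.f_integrable numu)).
- exact: emeasurable_funM.
- by move=> x _; rewrite mule_ge0// Radon_Nikodym_SigmaFinite.f_ge0.
- by move=> x _; rewrite mule_ge0// lee_fin.
- by apply: filterS ae => x /(_ I) /= <-.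
Qed.

End density_measure.

(** * Integrals of bounded functions *)

Section bounded_integrals.
Local Open Scope ereal_scope.
Context {d} {T : measurableType d} {R : realType}.
Implicit Types (P Q : probability T R) (f g : T -> R).

(** Monotonicity holds for all measurable functions since [+oo - +oo = -oo] is
    the value of an undefined integral: as [f <= g], the positive part of [f] is
    the smaller one and its negative part the larger one. *)
Lemma le_integral_measurable (mu : {measure set T -> \bar R}) (f g : T -> \bar R) :
  measurable_fun setT f -> measurable_fun setT g -> (forall x, f x <= g x) ->
  \int[mu]_x f x <= \int[mu]_x g x.
Proof.
move=> mf mg fg; rewrite integralE [leRHS]integralE leeB//.
- apply: ge0_le_integral => //; [exact: measurable_funepos..|].
  by move=> x _; apply: (@funepos_le _ _ setT) => //; rewrite inE.
- apply: ge0_le_integral => //; [exact: measurable_funeneg..|].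
  by move=> x _; apply: (@funeneg_le _ _ setT) => //; rewrite inE.
Qed.

Lemma bounded_integrable P f (C : R) : measurable_fun setT f ->
  (forall x, `|f x| <= C)%R -> P.-integrable setT (EFin \o f).
Proof.
move=> mf fC; apply: measurable_bounded_integrable => //.
  by rewrite (le_lt_trans (probability_le1 P measurableT))// ltry.
exists C; split; first exact: num_real.
by move=> y Cy x _ /=; rewrite (le_trans (fC x))// ltW.
Qed.

Lemma EFin_Rintegral P f : P.-integrable setT (EFin \o f) ->
  \int[P]_x (f x)%:E = (\int[P]_x f x)%R%:E.
Proof. by move=> fi; rewrite fineK//; exact: integrable_fin_num. Qed.

(** The nonnegative case, applied to [f + C]. *)
Lemma integral_density_bounded P Q (w f : T -> R) (C : R) :
  measurable_fun setT w -> (forall x, 0 <= w x)%R ->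
  (forall A, measurable A -> Q A = \int[P]_(x in A) (w x)%:E) ->
  measurable_fun setT f -> (forall x, `|f x| <= C)%R ->
  P.-integrable setT (EFin \o (f \* w)%R) /\
  \int[Q]_x (f x)%:E = \int[P]_x (f x * w x)%:E.
Proof.
move=> mw w0 QE mf fC.
have C0 : (0 <= C)%R by rewrite (le_trans _ (fC point)).
have w1 : \int[P]_x (w x)%:E = 1.
  rewrite -(QE _ measurableT). exact: probability_setT.
have wi : P.-integrable setT (EFin \o w).
  apply/integrableP; split; first exact/measurable_EFinP.
  by under eq_integral do rewrite gee0_abs ?lee_fin//; rewrite w1 ltry.
have fwi : P.-integrable setT (EFin \o (f \* w)%R).
  apply: (le_integrable measurableT _ _ (integrableZl measurableT C wi)).
    by apply/measurable_EFinP; exact: measurable_funM.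
  move=> x _ /=; rewrite lee_fin !normrM (ger0_norm (w0 x)) (ger0_norm C0).
  by rewrite ler_wpM2r.
split => //.
have fQ := bounded_integrable Q mf fC.
have mfC : measurable_fun setT (fun x => (f x + C)%:E).
  by apply/measurable_EFinP; exact: measurable_funD.
have fC0 x : 0 <= (f x + C)%:E.
  by rewrite lee_fin; have := fC x; rewrite ler_norml => /andP[]; lra.
have := integral_density mw w0 QE mfC fC0.
under eq_integral do rewrite EFinD.
rewrite integralD//; last first.
  exact: (@bounded_integrable Q (cst C) `|C|%R).
under [in RHS]eq_integral do rewrite -EFinM mulrDl EFinD.
rewrite integralD//; last exact: (integrableZl measurableT C wi).
under [X in _ = _ + X]eq_integral do rewrite EFinM.
rewrite integralZl// w1 integral_cst// [X in _ * X](probability_setT Q).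
by move=> /(congr1 (fun z => z - C%:E)); rewrite mule1 !addeK.
Qed.

End bounded_integrals.

(** * Gluing two probability spaces along a countable partition *)

Section gluing_weight.
Local Open Scope ereal_scope.
Context {d d'} {T : measurableType d} {T' : measurableType d'} {R : realType}.
Variables (p : probability T R) (q : probability T' R).
Variables (i : T -> nat) (j : T' -> nat).
Hypotheses (mi : measurable_fun setT i) (mj : measurable_fun setT j).
Hypothesis ij : forall n, p (i @^-1` [set n]) = q (j @^-1` [set n]).

(** The glued measure makes [z.1] and [z.2] independent given their common cell.
    It has the density [glue_weight] with respect to the product measure; on the
    cells of measure [0], the convention [0^-1 = 0] makes it vanish. *)
Definition cell_weight n : R := (fine (p (i @^-1` [set n])))^-1.
Definition glue_weight (z : T * T') : R :=
  (cell_weight (i z.1) * (i z.1 == j z.2)%:R)%R.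
Local Notation c := cell_weight.
Local Notation w := glue_weight.

Let mi1 n : measurable (i @^-1` [set n]).
Proof. by rewrite -[X in measurable X]setTI; exact: mi. Qed.
Let mj1 n : measurable (j @^-1` [set n]).
Proof. by rewrite -[X in measurable X]setTI; exact: mj. Qed.

Let c0 n : (0 <= c n)%R.
Proof. by rewrite invr_ge0 fine_ge0. Qed.

Lemma glue_weight_ge0 z : (0 <= w z)%R.
Proof. by rewrite mulr_ge0. Qed.

Lemma measurable_glue_weight : measurable_fun setT w.
Proof.
apply: measurable_funM.
  have mc : measurable_fun setT c by [].
  by apply: (measurableT_comp mc); exact: measurableT_comp.
have -> : (fun z : T * T' => (i z.1 == j z.2)%:R) =
    \1_[set z : T * T' | i z.1 == j z.2] :> (_ -> R).
  by apply/funext => z; rewrite indicE; congr (nat_of_bool _)%:R;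
    apply/idP/idP => [/mem_set//|/set_mem].
apply: measurable_indic.
rewrite -[X in measurable X]setTI.
have /= mb : measurable_fun setT (fun z : T * T' => i z.1 == j z.2).
  by apply: measurable_fun_eqn; exact: measurableT_comp.
by have := mb measurableT [set true] I; rewrite setTI.
Qed.

Lemma glue_weight_marginal (F : T -> \bar R) : measurable_fun setT F ->
  (forall x, 0 <= F x) -> \int[p \x q]_z (F z.1 * (w z)%:E) = \int[p]_x F x.
Proof.
move=> mF F0.
have mFw : measurable_fun setT (fun z : T * T' => F z.1 * (w z)%:E).
  apply: emeasurable_funM; first exact: measurableT_comp.
  by apply/measurable_EFinP; exact: measurable_glue_weight.
have Fw0 (z : T * T') : 0 <= F z.1 * (w z)%:E.
  by apply: mule_ge0 => //; rewrite lee_fin glue_weight_ge0.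
(* Outside of the null cells, [w (x, _)] has integral [1]. *)
rewrite fubini_tonelli1//=.
pose N := [set x | p (i @^-1` [set i x]) = 0].
have NE : N = \bigcup_(n in [set n | p (i @^-1` [set n]) = 0]) i @^-1` [set n].
  by apply/seteqP; split=> [x Nx|x [n pn /= ixn]]; [exists (i x)|rewrite /N/= ixn].
have mN : measurable N by rewrite NE; exact: bigcup_measurable.
have N0 : p N = 0.
  have : p.-negligible N.
    rewrite NE bigcup_mkcond; apply: negligible_bigcup => n.
    by case: ifPn => [/[!inE] pn|_];
      [exists (i @^-1` [set n]); split|exact: negligible_set0].
  by move/negligibleP; exact.
apply: ge0_ae_eq_integral => //.
- exact: measurable_fun_fubini_tonelli_F mFw Fw0.
- by move=> x _; apply: integral_ge0 => y _; exact: (Fw0 (x, y)).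
exists N; split => // x /= /not_implyP[_].
apply: contra_notP => Nx.
have pfin : p (i @^-1` [set i x]) \is a fin_num by rewrite fin_num_measure.
have ck : (c (i x) * fine (p (i @^-1` [set i x])) = 1)%R.
  by rewrite mulVf// fine_eq0//; apply/eqP.
rewrite /fubini_F/=.
rewrite ge0_integralZl//; last 2 first.
- by apply/measurable_EFinP; exact: (measurableT_comp measurable_glue_weight).
- by move=> y _; rewrite lee_fin glue_weight_ge0.
rewrite -[RHS]mule1; congr (_ * _).
transitivity (\int[q]_y ((c (i x))%:E * (\1_(j @^-1` [set i x]) y)%:E)).
  apply: eq_integral => y _; rewrite /glue_weight/= EFinM; congr (_ * _%:E).
  rewrite indicE; congr (nat_of_bool _)%:R.
  by apply/idP/idP => [/eqP xy|/[!inE]/= ->//]; rewrite inE.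
rewrite ge0_integralZl_EFin//; last by apply/measurable_EFinP/measurable_indic.
rewrite integral_indic// setIT.
transitivity ((c (i x))%:E * p (i @^-1` [set i x])).
  by congr (_ * _); exact/esym/ij.
by rewrite -(fineK pfin) -EFinM ck.
Qed.

End gluing_weight.

Section gluing.
Local Open Scope ereal_scope.
Context {d d'} {T : measurableType d} {T' : measurableType d'} {R : realType}.
Variables (p : probability T R) (q : probability T' R).
Variables (i : T -> nat) (j : T' -> nat).
Hypotheses (mi : measurable_fun setT i) (mj : measurable_fun setT j).
Hypothesis ij : forall n, p (i @^-1` [set n]) = q (j @^-1` [set n]).

(** A coupling of [p] and [q] that lives on the pairs of points of the same cell
    exists as soon as the cells have the same measure for [p] and for [q]. For
    couplings with a common middle marginal and cells of small diameter, it
    replaces the gluing lemma, and no disintegration of measures is called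
    for. *)
Lemma glue_along : exists pi : probability (T * T')%type R,
  [/\ forall A, measurable A -> pi (A `*` setT) = p A,
      forall A, measurable A -> pi (setT `*` A) = q A
    & {ae pi, forall z, i z.1 = j z.2}].
Proof.
pose mu := (p \x q)%E; pose w := glue_weight p i j.
have mw : measurable_fun setT w by exact: measurable_glue_weight.
have w0 z : (0 <= w z)%R by exact: glue_weight_ge0.
have left_marginal (F : T -> \bar R) : measurable_fun setT F ->
    (forall x, 0 <= F x) -> \int[mu]_z (F z.1 * (w z)%:E) = \int[p]_x F x.
  exact: glue_weight_marginal.
have right_marginal (F : T' -> \bar R) : measurable_fun setT F ->
    (forall x, 0 <= F x) -> \int[mu]_z (F z.2 * (w z)%:E) = \int[q]_x F x.
  move=> mF F0; pose w' := glue_weight q j i.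
  have mw' : measurable_fun setT w' by exact: measurable_glue_weight.
  have w'0 z : (0 <= w' z)%R by exact: glue_weight_ge0.
  transitivity (\int[q \x p]_z (F z.1 * (w' z)%:E)); last first.
    by apply: glue_weight_marginal => // n; exact/esym/ij.
  have mf : measurable_fun setT (fun z : T * T' => F z.2 * (w z)%:E).
    apply: emeasurable_funM; first exact: measurableT_comp.
    exact/measurable_EFinP.
  have f0 (z : T * T') : 0 <= F z.2 * (w z)%:E by rewrite mule_ge0// lee_fin.
  have mf' : measurable_fun setT (fun z : T' * T => F z.1 * (w' z)%:E).
    apply: emeasurable_funM; first exact: measurableT_comp.
    exact/measurable_EFinP.
  have f'0 (z : T' * T) : 0 <= F z.1 * (w' z)%:E by rewrite mule_ge0// lee_fin.
  transitivity (\int[q]_y \int[p]_x (F y * (w (x, y))%:E)).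
    exact: (fubini_tonelli2 _ mf f0).
  transitivity (\int[q]_y \int[p]_x (F y * (w' (y, x))%:E)); last first.
    exact/esym/(fubini_tonelli1 _ mf' f'0).
  apply: eq_integral => y _; apply: eq_integral => x _; congr (_ * _%:E).
  rewrite /w /w' /glue_weight /cell_weight/=.
  have [->|_] := eqVneq (i x) (j y); last by rewrite !mulr0.
  by congr ((fine _)^-1 * _)%R; exact: ij.
have w1 : \int[mu]_z (w z)%:E = 1.
  transitivity (\int[mu]_z (cst 1 z.1 * (w z)%:E)).
    by apply: eq_integral => z _; rewrite mul1e.
  by rewrite left_marginal// integral_cst// mul1e; exact: probability_setT.
have [pi piE] := density_probability mw w0 w1.
exists pi; split=> [A mA|A mA|].
- apply: (eq_trans (piE _)); rewrite integral_mkcond/=.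
  transitivity (\int[p]_x (\1_A x)%:E); last by rewrite integral_indic// setIT.
  rewrite -left_marginal//; last exact/measurable_EFinP/measurable_indic.
  apply: eq_integral => z _; rewrite patchE indicE in_setX in_setT andbT.
  by case: ifP; rewrite ?mul1e ?mul0e.
- apply: (eq_trans (piE _)); rewrite integral_mkcond/=.
  transitivity (\int[q]_x (\1_A x)%:E); last by rewrite integral_indic// setIT.
  rewrite -right_marginal//; last exact/measurable_EFinP/measurable_indic.
  apply: eq_integral => z _; rewrite patchE indicE in_setX in_setT/=.
  by case: ifP; rewrite ?mul1e ?mul0e.
exists [set z | i z.1 != j z.2]; split.
- rewrite -[X in measurable X]setTI.
  have /= mb : measurable_fun setT (fun z : T * T' => i z.1 == j z.2).
    by apply: measurable_fun_eqn; exact: measurableT_comp.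
  have mf := mb measurableT [set false] I.
  congr measurable: mf; apply/seteqP; split=> z /=;
    [by case=> _ ->|by case=> _ /negbTE ->].
- apply: (eq_trans (piE _)); apply: integral0_eq => z /= /negbTE zij.
  by rewrite /w /glue_weight zij mulr0.
- by move=> z /= /eqP.
Qed.

End gluing.

(** * Marginals of a probability measure on a product *)

Section fst_marginal.
Local Open Scope ereal_scope.
Context {d d'} {T : measurableType d} {T' : measurableType d'} {R : realType}.
Variables (pi : probability (T * T')%type R) (p : probability T R).
Hypothesis pip : forall A, measurable A -> pi (A `*` setT) = p A.

Let integral_pushforward_fst (F : T -> \bar R) :
  \int[pushforward pi fst]_x F x = \int[p]_x F x.
Proof.
apply: eq_measure_integral => A mA _.
transitivity (pi (A `*` setT)); last exact: pip.
by rewrite /pushforward; congr (pi _); apply/seteqP; split=> [z ?|z []].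
Qed.

Lemma integral_fst_marginal (F : T -> \bar R) :
  measurable_fun setT F -> (forall x, 0 <= F x) ->
  \int[pi]_z F z.1 = \int[p]_x F x.
Proof.
move=> mF F0; rewrite -integral_pushforward_fst.
by rewrite (@ge0_integral_pushforward _ _ _ _ _ fst _ pi setT F).
Qed.

Lemma integral_fst_marginal_bounded (f : T -> R) (C : R) :
  measurable_fun setT f -> (forall x, `|f x| <= C)%R ->
  \int[pi]_z (f z.1)%:E = \int[p]_x (f x)%:E.
Proof.
move=> mf fC.
have mEf : measurable_fun setT (EFin \o f) by exact/measurable_EFinP.
have mfz : measurable_fun setT (f \o fst : T * T' -> R).
  exact: measurableT_comp.
have fi : pi.-integrable (fst @^-1` setT) ((EFin \o f) \o fst).
  exact: (bounded_integrable pi mfz (fun z => fC z.1)).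
by rewrite -integral_pushforward_fst (integral_pushforward measurable_fst mEf fi).
Qed.

End fst_marginal.

Section snd_marginal.
Local Open Scope ereal_scope.
Context {d d'} {T : measurableType d} {T' : measurableType d'} {R : realType}.
Variables (pi : probability (T * T')%type R) (q : probability T' R).
Hypothesis piq : forall A, measurable A -> pi (setT `*` A) = q A.

Let integral_pushforward_snd (F : T' -> \bar R) :
  \int[pushforward pi snd]_x F x = \int[q]_x F x.
Proof.
apply: eq_measure_integral => A mA _.
transitivity (pi (setT `*` A)); last exact: piq.
by rewrite /pushforward; congr (pi _); apply/seteqP; split=> [z ?|z []].
Qed.

Lemma integral_snd_marginal (F : T' -> \bar R) :
  measurable_fun setT F -> (forall x, 0 <= F x) ->
  \int[pi]_z F z.2 = \int[q]_x F x.
Proof.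
move=> mF F0; rewrite -integral_pushforward_snd.
by rewrite (@ge0_integral_pushforward _ _ _ _ _ snd _ pi setT F).
Qed.

Lemma integral_snd_marginal_bounded (f : T' -> R) (C : R) :
  measurable_fun setT f -> (forall x, `|f x| <= C)%R ->
  \int[pi]_z (f z.2)%:E = \int[q]_x (f x)%:E.
Proof.
move=> mf fC.
have mEf : measurable_fun setT (EFin \o f) by exact/measurable_EFinP.
have mfz : measurable_fun setT (f \o snd : T * T' -> R).
  exact: measurableT_comp.
have fi : pi.-integrable (snd @^-1` setT) ((EFin \o f) \o snd).
  exact: (bounded_integrable pi mfz (fun z => fC z.2)).
by rewrite -integral_pushforward_snd (integral_pushforward measurable_snd mEf fi).
Qed.

End snd_marginal.

(** * Borel sets of a separable metric space *)

Section borel.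
Local Open Scope ereal_scope.
Context {R : realType} {X : completeMetricType R}.

Lemma open_borel (A : set X) : open A -> measurable (A : set (borel X)).
Proof. exact: sub_sigma_algebra. Qed.

Lemma open_of_balls (A : set X) :
  (forall x, A x -> exists2 e : R, (0 < e)%R & forall y, (mdist x y < e)%R -> A y) ->
  open A.
Proof.
move=> Ax; rewrite openE => x /Ax[e e0 xA].
by apply/nbhs_ballP; exists e => //= y; rewrite ballEmdist => /xA.
Qed.

Lemma open_ball_metric (x : X) (r : R) : open (ball x r).
Proof.
apply: open_of_balls => y; rewrite ballEmdist/= => xy.
exists (r - mdist x y)%R; first by rewrite subr_gt0.
by move=> z yz; have := metric_triangle x y z; lra.
Qed.

Lemma measurable_metric_ball (x : X) (r : R) : measurable (ball x r : set (borel X)).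
Proof. by apply: open_borel; exact: open_ball_metric. Qed.

(** Lower semicontinuity, in the form in which it is available for local
    Lipschitz constants. *)
Lemma open_gt_measurable (f : X -> R) :
  (forall a, open [set x | (a < f x)%R]) -> measurable_fun setT (f : borel X -> R).
Proof.
move=> of_; apply: (measurability _ (RGenOInfty.measurableE R)).
move=> _ [_ [a ->] <-]; rewrite setTI preimage_itvoy.
exact: open_borel.
Qed.

Lemma lipschitz_measurable (f : X -> R) (L : R) :
  (forall x y, `|f x - f y| <= L * mdist x y)%R ->
  measurable_fun setT (f : borel X -> R).
Proof.
move=> fL; apply: open_gt_measurable => a; apply: open_of_balls => x /= ax.
have L0 : (0 < `|L| + 1)%R by rewrite ltr_wpDl.
exists ((f x - a) / (`|L| + 1))%R; first by rewrite divr_gt0// subr_gt0.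
move=> y; rewrite ltr_pdivlMr// => xy.
have := fL x y; have := mdist_ge0 x y; have := ler_norm L.
have := ler_norm (f x - f y)%R; move: xy; nra.
Qed.

Lemma measurable_mdistl (x : X) : measurable_fun setT ((mdist x : X -> R) : borel X -> R).
Proof.
apply: (@lipschitz_measurable _ 1) => y z; rewrite mul1r ler_norml.
have := metric_triangle x y z; have := metric_triangle x z y.
rewrite (metric_sym z y) => h1 h2; apply/andP; split; lra.
Qed.

Hypothesis sepX : separable X.

Lemma dense_sequence :
  exists s : nat -> X, forall x (r : R), (0 < r)%R -> exists n, (mdist (s n) x < r)%R.
Proof.
have [S cS dS] := sepX.
have [s sS] : exists s : nat -> X, set_surj setT S s by apply/pcard_surjP.
exists s => x r r0.
have [] := dS (ball x r) _ (open_ball_metric x r); first by exists x; exact: ballxx.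
move=> y []; rewrite ballEmdist/= => xy Sy.
have [n _ sny] := sS _ Sy; exists n.
by rewrite sny metric_sym.
Qed.

(** Measurability is for the product of the Borel sigma-algebras, whence the need
    for separability: [d (x, y) < a] holds if and only if
    [d (s, x) + d (s, y) < a] for some [s] in a fixed dense sequence. *)
Lemma measurable_mdist :
  measurable_fun setT (fun z : borel X * borel X => mdist (z.1 : X) (z.2 : X)).
Proof.
have [s sd] := dense_sequence.
apply: (measurability _ (RGenInftyO.measurableE R)).
move=> _ [_ [a ->] <-]; rewrite setTI preimage_itvNyo.
pose g n (z : borel X * borel X) := (mdist (s n) (z.1 : X) + mdist (s n) (z.2 : X))%R.
have -> : [set z : borel X * borel X | (mdist (z.1 : X) (z.2 : X) < a)%R] =
    \bigcup_n (g n @^-1` `]-oo, a[).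
  apply/seteqP; split=> [[x y] /= xya|[x y] [n _]]; last first.
    rewrite /g /= in_itv/= => ga; have := metric_triangle x (s n) y.
    rewrite (metric_sym x (s n)); lra.
  have [n sn] := sd x ((a - mdist x y) / 2)%R ltac:(lra).
  exists n => //; rewrite /g/= in_itv/=.
  have := metric_triangle (s n) x y; lra.
apply: bigcup_measurable => n _; rewrite -[X in measurable X]setTI.
suff : measurable_fun setT (g n) by apply.
by apply: measurable_funD;
  apply: (measurableT_comp (measurable_mdistl (s n))).
Qed.

(** The cell of [x] is numbered by the first point of a dense sequence at
    distance less than [e / 2] from [x]. *)
Lemma measurable_cells (e : R) : (0 < e)%R ->
  exists2 k : borel X -> nat, measurable_fun setT k &
    forall x y : X, k x = k y -> (mdist x y < e)%R.
Proof.
move=> e0; have [s sd] := dense_sequence.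
have e20 : (0 < e / 2)%R by rewrite divr_gt0.
pose k (x : borel X) := ex_minn (sd x (e / 2)%R e20).
have kP x : (mdist (s (k x)) x < e / 2)%R by rewrite /k; case: ex_minnP.
exists k; last first.
  move=> x y kxy; have := kP x; have := kP y; rewrite -kxy.
  have := metric_triangle x (s (k x)) y; rewrite (metric_sym x (s _)); lra.
pose B n : set (borel X) := [set x | (mdist (s n) x < e / 2)%R].
have mB n : measurable (B n).
  by have := measurable_metric_ball (s n) (e / 2)%R; rewrite ballEmdist.
have kE n : k @^-1` [set n] = B n `\` \bigcup_(i in [set i | (i < n)%N]) B i.
  apply/seteqP; split=> [x /= kx|x [Bn Bi]]; last first.
    rewrite /= /k; case: ex_minnP => m Bm mmin.
    apply/eqP; rewrite eqn_leq mmin// leqNgt; apply/negP => mn.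
    by apply: Bi; exists m.
  split; first by rewrite /B/= -kx.
  move=> [i /= ilt Bi]; move: kx; rewrite /k; case: ex_minnP => m _ mmin mn.
  by have := mmin i Bi; rewrite mn leqNgt ilt.
move=> _ Y _; rewrite setTI.
have -> : k @^-1` Y = \bigcup_(n in Y) k @^-1` [set n].
  by apply/seteqP; split=> [x Yx|x [n Yn /= ->]//]; exists (k x).
apply: bigcup_measurable => n _; rewrite kE; apply: measurableD => //.
exact: bigcup_measurable.
Qed.

End borel.

(** * Displacement of mass along a Wasserstein geodesic *)

Section transport.
Local Open Scope ereal_scope.
Context {R : realType} {X : completeMetricType R}.
Implicit Types mu nu : probability (borel X) R.

Definition cost (p : probability (borel X * borel X)%type R) : \bar R :=
  \int[p]_z ((mdist (z.1 : X) (z.2 : X)) ^+ 2)%:E.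

Lemma cost_ge0 p : 0 <= cost p.
Proof. by apply: integral_ge0 => z _; rewrite lee_fin sqr_ge0. Qed.

Lemma W2_cost_inf mu nu (w : R) : (0 <= w)%R -> W2 mu nu = w%:E ->
  ereal_inf [set cost p | p in coupling mu nu] = (w ^+ 2)%:E.
Proof.
rewrite /W2 => w0; set i := ereal_inf _.
have : 0 <= i by apply: le_ereal_inf_tmp => _ [p _ <-]; exact: cost_ge0.
case: i => [r| |]//= r0 [<-].
by rewrite sqr_sqrtr.
Qed.

Lemma W2_le_cost mu nu p (w : R) : (0 <= w)%R -> W2 mu nu = w%:E ->
  coupling mu nu p -> (w ^+ 2)%:E <= cost p.
Proof.
move=> w0 Ww pc; rewrite -(W2_cost_inf w0 Ww).
by apply: ereal_inf_lbound; exists p.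
Qed.

Lemma W2_near_optimal mu nu (w e : R) : (0 <= w)%R -> W2 mu nu = w%:E ->
  (0 < e)%R -> exists2 p, coupling mu nu p & cost p <= (w ^+ 2 + e)%:E.
Proof.
move=> w0 Ww e0; have ifin := W2_cost_inf w0 Ww.
have ifn : ereal_inf [set cost p | p in coupling mu nu] \is a fin_num.
  by rewrite ifin.
have [_ [p pc <-] pe] := lb_ereal_inf_adherent e0 ifn.
by exists p => //; rewrite ltW// EFinD -ifin.
Qed.

End transport.

(** Here [a], [b], [c] are the distances from the position at time [0] to that at
    time [t], from the latter to that at time [1], and between the end points.
    With [S = a + b], the identity
    [a^2 / t + b^2 / (1 - t) = S^2 + (a - t S)^2 / (t (1 - t))] shows that
    [a^2 / t + b^2 / (1 - t) - c^2], whose mean is the defect of optimality,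
    dominates the squares of [a - t S] and of [S - c]; then
    [a - t D <= (a - t S) + t (S - c)], and each term is at most [k] plus its square
    divided by [4 k]. The weight [g] is to be the gradient. *)
Lemma displacement_pointwise (R : realType) (a b c t D k g L : R) :
  0 <= g <= L -> 0 <= c -> c <= a + b -> c <= D -> 0 < t -> t < 1 -> 0 < k ->
  g * a + L * (4 * k)^-1 * c ^+ 2 <=
  t * D * g + 2 * L * k + L * (4 * k)^-1 * (t^-1 * a ^+ 2 + (1 - t)^-1 * b ^+ 2).
Proof.
move=> /andP[g0 gL] c0 cab cD t0 t1 k0.
have t10 : 0 < 1 - t by rewrite subr_gt0.
set S := a + b.
have -> : t^-1 * a ^+ 2 + (1 - t)^-1 * b ^+ 2 =
    S ^+ 2 + (t * (1 - t))^-1 * (a - t * S) ^+ 2.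
  rewrite /S; field; lra.
have k40 : 0 < 4 * k by rewrite mulr_gt0.
set u := a - t * S.
have tt1 : t * (1 - t) <= 1 by nra.
have tt0 : 0 < t * (1 - t) by nra.
have h1 : u ^+ 2 <= (t * (1 - t))^-1 * u ^+ 2.
  by rewrite ler_peMl ?sqr_ge0// invf_ge1.
have h2 : 4 * k * u <= 4 * k ^+ 2 + u ^+ 2.
  by rewrite -subr_ge0 (_ : _ - _ = (2 * k - u) ^+ 2) ?sqr_ge0//; ring.
set v := t * (S - c).
have h3 : 4 * k * v <= 4 * k ^+ 2 + v ^+ 2.
  by rewrite -subr_ge0 (_ : _ - _ = (2 * k - v) ^+ 2) ?sqr_ge0//; ring.
have h4 : v ^+ 2 <= (S - c) ^+ 2.
  rewrite /v exprMn ler_piMl ?sqr_ge0// expr_le1//; lra.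
have h5 : (S - c) ^+ 2 <= S ^+ 2 - c ^+ 2.
  by rewrite -subr_ge0 (_ : _ - _ = 2 * c * (S - c)) ?mulr_ge0 ?subr_ge0//; ring.
have h6 : 4 * k * (t * (c - D)) <= 0.
  by rewrite !pmulr_rle0// subr_le0.
have main : 4 * k * a + c ^+ 2 <=
    4 * k * (t * D) + 8 * k ^+ 2 + (S ^+ 2 + (t * (1 - t))^-1 * u ^+ 2).
  have aE : a = u + v + t * c by rewrite /u /v; ring.
  have -> : 4 * k * a = 4 * k * u + 4 * k * v + 4 * k * (t * c).
    by rewrite {1}aE; ring.
  lra.
set Q := S ^+ 2 + _ in main *.
have Qc : c ^+ 2 <= Q.
  have cS : c ^+ 2 <= S ^+ 2 by rewrite ler_pXn2r// nnegrE (le_trans c0).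
  by rewrite /Q (le_trans cS)// lerDl mulr_ge0 ?sqr_ge0// invr_ge0 ltW.
pose N := 2 * k + (4 * k)^-1 * (Q - c ^+ 2).
have N0 : 0 <= N.
  by rewrite addr_ge0 ?mulr_ge0 ?subr_ge0 ?invr_ge0 ?mulr_ge0// ltW.
have aN : a - t * D <= N.
  rewrite -subr_ge0 (_ : N - _ = (4 * k)^-1 *
      (4 * k * (t * D) + 8 * k ^+ 2 + Q - (4 * k * a + c ^+ 2))).
    by rewrite mulr_ge0 ?subr_ge0// invr_ge0 ltW.
  by rewrite /N; field; rewrite gt_eqF.
have : g * (a - t * D) <= L * N.
  by rewrite (le_trans (ler_wpM2l g0 aN))// ler_wpM2r.
rewrite /N; lra.
Qed.

Section displacement.
Local Open Scope ereal_scope.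
Context {R : realType} {X : completeMetricType R}.
Hypothesis sepX : separable X.
Variables (mu0 mut mu1 : probability (borel X) R).
Variables (E : set (borel X)) (D : R).
Hypotheses (mE : measurable E) (mu0E : mu0 E = 1) (mu1E : mu1 E = 1).
Hypothesis diamE : forall x y : X, E x -> E y -> (mdist x y <= D)%R.
Variables (t W : R).
Hypotheses (t0 : (0 < t)%R) (t1 : (t < 1)%R) (W0 : (0 <= W)%R).
Hypothesis W2_01 : W2 mu0 mu1 = W%:E.

Let dist (z : borel X * borel X) : R := mdist (z.1 : X) (z.2 : X).
Let mdist2 : measurable_fun setT (fun z => (dist z) ^+ 2)%R.
Proof. by apply: measurable_funX; exact: measurable_mdist. Qed.

(** The integral of [displacement_pointwise] over the gluing of [p] and [q]. As
    the two middle points only lie in the same cell, the triangle inequality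
    costs [e], the diameter of the cells: whence [(b + e)^2 <= (1 + e) (b^2 + e)].
    The end points of the gluing are distributed by a coupling of [mu0] and [mu1],
    so that the mean of [c^2] is at least [W^2]. *)
Lemma displacement_glued (p q : probability (borel X * borel X)%type R)
    (e k L : R) (G : borel X -> R) :
  coupling mu0 mut p -> coupling mut mu1 q ->
  (0 < e)%R -> (0 < k)%R -> (0 <= L)%R ->
  measurable_fun setT G -> (forall x, 0 <= G x <= L)%R ->
  \int[p]_z (G z.1 * dist z)%:E + (L * (4 * k)^-1 * W ^+ 2)%:E <=
  (t * D)%:E * \int[mu0]_x (G x)%:E + (2 * L * k)%:E
  + (L * (4 * k)^-1 * t^-1)%:E * cost p
  + (L * (4 * k)^-1 * (1 - t)^-1 * (1 + e))%:E * (cost q + e%:E).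
Proof.
move=> pc qc e0 k0 L0 mG GL.
have t10 : (0 < 1 - t)%R by rewrite subr_gt0.
have [t0' k0' e0' t10'] : [/\ 0 <= t, 0 <= k, 0 <= e & 0 <= 1 - t]%R.
  by split; exact: ltW.
have k4' : (0 <= 4 * k)%R by rewrite mulr_ge0.
have dist0 z : (0 <= dist z)%R by exact: mdist_ge0.
have [cell mcell cellP] := measurable_cells sepX e0.
pose i (z : borel X * borel X) := cell z.2.
pose j (z : borel X * borel X) := cell z.1.
have mi : measurable_fun setT i by exact: measurableT_comp.
have mj : measurable_fun setT j by exact: measurableT_comp.
have mc n : measurable (cell @^-1` [set n]).
  by rewrite -[X in measurable X]setTI; exact: mcell.
have ij n : p (i @^-1` [set n]) = q (j @^-1` [set n]).
  transitivity (mut (cell @^-1` [set n])).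
    rewrite -(pc _ (mc n)).2; congr (p _).
    by apply/seteqP; split=> [z ?|z []].
  rewrite -(qc _ (mc n)).1; congr (q _).
  by apply/seteqP; split=> [z []|z ?].
have [pi [pi1 pi2 piij]] := glue_along mi mj ij.
pose ends (z : (borel X * borel X) * (borel X * borel X)) := (z.1.1, z.2.2).
have mends : measurable_fun setT ends.
  apply: measurable_fun_pair; first exact: (measurableT_comp measurable_fst measurable_fst).
  exact: (measurableT_comp measurable_snd measurable_snd).
have D0 : (0 <= D)%R.
  have [x Ex] : E !=set0.
    apply/set0P/eqP => E0; move: mu0E; rewrite E0 measure0 => /eqP.
    by rewrite eq_sym onee_eq0.
  by rewrite (le_trans (mdist_ge0 x x))// diamE.
pose a0 := (L * (4 * k)^-1)%R.
have a00 : (0 <= a0)%R by rewrite mulr_ge0// invr_ge0 mulr_ge0// ltW.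
pose G1 (x : borel X * borel X) :=
  (t * D * G x.1 + 2 * L * k + a0 * t^-1 * dist x ^+ 2)%R.
pose G2 (y : borel X * borel X) :=
  (a0 * (1 - t)^-1 * (1 + e) * (dist y ^+ 2 + e))%R.
have G1_0 x : (0 <= G1 x)%R.
  have /andP[G0 _] := GL x.1.
  apply: addr_ge0; first apply: addr_ge0; rewrite !mulr_ge0 ?invr_ge0//.
have G2_0 x : (0 <= G2 x)%R.
  by rewrite !mulr_ge0 ?addr_ge0 ?invr_ge0 ?mulr_ge0.
have mG1 : measurable_fun setT G1.
  apply: measurable_funD; last exact: measurable_funM.
  by apply: measurable_funD => //; apply: measurable_funM => //; exact: measurableT_comp.
have mG2 : measurable_fun setT G2.
  by apply: measurable_funM => //; exact: measurable_funD.
pose F (z : (borel X * borel X) * (borel X * borel X)) :=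
  (G z.1.1 * dist z.1 + a0 * dist (ends z) ^+ 2)%R.
have mdist1 : measurable_fun setT dist by exact: measurable_mdist.
have mGd : measurable_fun setT (fun z => G z.1 * dist z)%R.
  by apply: measurable_funM => //; exact: measurableT_comp.
have Gd0 z : (0 <= G z.1 * dist z)%R.
  by have /andP[G0 _] := GL z.1; rewrite mulr_ge0// mdist_ge0.
have F0 z : (0 <= F z)%R.
  by rewrite addr_ge0// mulr_ge0// sqr_ge0.
have mF1 : measurable_fun setT
    (fun z : (borel X * borel X) * (borel X * borel X) => G z.1.1 * dist z.1)%R.
  by apply: (measurableT_comp mGd).
have mF2 : measurable_fun setT
    (fun z : (borel X * borel X) * (borel X * borel X) => a0 * dist (ends z) ^+ 2)%R.
  by apply: measurable_funM => //; apply: (measurableT_comp mdist2).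
have mF : measurable_fun setT F by exact: measurable_funD.
have FG : {ae pi, forall z, F z <= G1 z.1 + G2 z.2}%R.
  have mCE := measurableC mE.
  have aeE1 : {ae pi, forall z, E z.1.1}.
    exists ((~` E `*` setT) `*` setT); split => [||z nEz].
    - by apply: measurableX => //; exact: measurableX.
    - rewrite pi1; last exact: measurableX.
      by apply: (eq_trans (pc _ mCE).1); rewrite probability_setC// mu0E subee.
    - by split => //; split => // /nEz.
  have aeE2 : {ae pi, forall z, E z.2.2}.
    exists (setT `*` (setT `*` ~` E)); split => [||z nEz].
    - by apply: measurableX => //; exact: measurableX.
    - rewrite pi2; last exact: measurableX.
      by apply: (eq_trans (qc _ mCE).2); rewrite probability_setC// mu1E subee.
    - by split => //; split => // /nEz.
  apply: filterS3 piij aeE1 aeE2 => -[[x y] [y' x']] /= yy' Ex Ex'.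
  have := cellP _ _ yy'; have /andP[Gx0 GxL] := GL x.
  rewrite /F /G1 /G2 /dist/= => yye.
  have tri : (mdist x x' <= mdist x y + (mdist y' x' + e))%R.
    have := metric_triangle x y x'; have := metric_triangle y y' x'; lra.
  have GLx : (0 <= G x <= L)%R by exact: GL.
  have dp := displacement_pointwise GLx (mdist_ge0 x x') tri
    (diamE Ex Ex') t0 t1 k0.
  apply: (le_trans dp); rewrite -/a0 -[leRHS]addrA lerD2l mulrDr mulrA lerD2l.
  rewrite -[leRHS]mulrA -[leRHS]mulrA ler_wpM2l// ler_wpM2l ?invr_ge0//.
  rewrite -subr_ge0 (_ : _ - _ = e * (mdist y' x' - 1) ^+ 2)%R; last by ring.
  by rewrite mulr_ge0// sqr_ge0.
have intF : \int[pi]_z (F z)%:E <= \int[pi]_z (G1 z.1)%:E + \int[pi]_z (G2 z.2)%:E.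
  rewrite -ge0_integralD//; last 4 first.
  - by move=> z _; rewrite lee_fin.
  - by apply/measurable_EFinP; exact: (measurableT_comp mG1).
  - by move=> z _; rewrite lee_fin.
  - by apply/measurable_EFinP; exact: (measurableT_comp mG2).
  apply: ae_ge0_le_integral => //.
  - by move=> z _; rewrite lee_fin.
  - exact/measurable_EFinP.
  - by move=> z _; rewrite adde_ge0// lee_fin.
  - apply: emeasurable_funD; apply/measurable_EFinP.
      exact: (measurableT_comp mG1).
    exact: (measurableT_comp mG2).
  - by apply: filterS FG => z FGz _; rewrite -EFinD lee_fin.
have FE : \int[pi]_z (F z)%:E =
    \int[p]_z (G z.1 * dist z)%:E + a0%:E * \int[pi]_z (dist (ends z) ^+ 2)%:E.
  rewrite /F; under eq_integral do rewrite EFinD.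
  rewrite ge0_integralD//; last 4 first.
  - by move=> z _; rewrite lee_fin.
  - exact/measurable_EFinP.
  - by move=> z _; rewrite lee_fin mulr_ge0// sqr_ge0.
  - exact/measurable_EFinP.
  congr (_ + _).
    apply: (integral_fst_marginal (F := fun z => (G z.1 * dist z)%:E) pi1).
      exact/measurable_EFinP.
    by move=> x; rewrite lee_fin.
  under eq_integral do rewrite EFinM.
  rewrite ge0_integralZl_EFin//; first by move=> z _; rewrite lee_fin sqr_ge0.
  by apply/measurable_EFinP; exact: (measurableT_comp mdist2).
have endsW : (W ^+ 2)%:E <= \int[pi]_z (dist (ends z) ^+ 2)%:E.
  pose Z : {mfun _ >-> _} := HB.pack ends (isMeasurableFun.Build _ _ _ _ _ mends).
  have <- : cost (distribution pi Z) = \int[pi]_z (dist (ends z) ^+ 2)%:E.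
    apply: (ge0_integral_pushforward mends) => //; first exact/measurable_EFinP.
    by move=> z _; rewrite lee_fin sqr_ge0.
  apply: (W2_le_cost W0 W2_01) => A mA; split.
  - rewrite -(pc A mA).1 -pi1; last exact: measurableX.
    rewrite /distribution /pushforward; congr (pi _).
    by apply/seteqP; split=> [z []|z [[]]].
  - rewrite -(qc A mA).2 -pi2; last exact: measurableX.
    rewrite /distribution /pushforward; congr (pi _).
    by apply/seteqP; split=> [z []|z [? []]].
have mEdist2 : measurable_fun setT (fun z => (dist z ^+ 2)%:E).
  exact/measurable_EFinP.
have mEG : measurable_fun setT (fun z : borel X * borel X => (G z.1)%:E).
  by apply/measurable_EFinP; exact: measurableT_comp.
have G0 x : (0 <= G x)%R by have /andP[] := GL x.
have G1E : \int[pi]_z (G1 z.1)%:E = (t * D)%:E * \int[mu0]_x (G x)%:E +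
    (2 * L * k)%:E + (a0 * t^-1)%:E * cost p.
  rewrite (integral_fst_marginal (F := EFin \o G1) pi1); last 2 first.
  - exact/measurable_EFinP.
  - by move=> x; rewrite lee_fin.
  rewrite /= /G1; under eq_integral do rewrite !EFinD (EFinM (t * D)) (EFinM (a0 * t^-1)).
  rewrite ge0_integralD//; last 4 first.
  - by move=> x _; rewrite adde_ge0 ?mule_ge0 ?lee_fin// !mulr_ge0.
  - by apply: emeasurable_funD => //; exact: emeasurable_funM.
  - by move=> x _; rewrite mule_ge0// lee_fin ?sqr_ge0// mulr_ge0// invr_ge0.
  - exact: emeasurable_funM.
  rewrite ge0_integralD//; last 3 first.
  - by move=> x _; rewrite mule_ge0 ?lee_fin// mulr_ge0.
  - exact: emeasurable_funM.
  - by move=> x _; rewrite lee_fin !mulr_ge0.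
  rewrite ge0_integralZl_EFin//; last 2 first.
  - by move=> x _; rewrite lee_fin.
  - by rewrite mulr_ge0.
  rewrite ge0_integralZl_EFin//; last 2 first.
  - by move=> x _; rewrite lee_fin sqr_ge0.
  - by rewrite mulr_ge0// invr_ge0.
  rewrite integral_cst// [X in _ + _ * X + _](probability_setT p) mule1.
  by rewrite (integral_fst_marginal (F := EFin \o G) (fun A mA => (pc A mA).1))//; exact/measurable_EFinP.
have G2E : \int[pi]_z (G2 z.2)%:E =
    (a0 * (1 - t)^-1 * (1 + e))%:E * (cost q + e%:E).
  rewrite (integral_snd_marginal (F := EFin \o G2) pi2); last 2 first.
  - exact/measurable_EFinP.
  - by move=> x; rewrite lee_fin.
  rewrite /= /G2; under eq_integral do rewrite EFinM.
  rewrite ge0_integralZl_EFin//; last 3 first.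
  - by move=> x _; rewrite lee_fin addr_ge0 ?sqr_ge0.
  - by apply/measurable_EFinP; exact: measurable_funD.
  - by rewrite !mulr_ge0// ?invr_ge0// addr_ge0.
  congr (_ * _); under eq_integral do rewrite EFinD.
  rewrite ge0_integralD//; last by move=> x _; rewrite lee_fin sqr_ge0.
  by rewrite integral_cst// [X in _ + _ * X](probability_setT q) mule1.
move: intF; rewrite FE G1E G2E; apply: le_trans.
by rewrite leeD2l// EFinM lee_wpmul2l// lee_fin.
Qed.

End displacement.

Section displacement_near_optimal.
Local Open Scope ereal_scope.
Context {R : realType} {X : completeMetricType R}.
Hypothesis sepX : separable X.
Variables (mu0 mut mu1 : probability (borel X) R).
Variables (E : set (borel X)) (D : R).
Hypotheses (mE : measurable E) (mu0E : mu0 E = 1) (mu1E : mu1 E = 1).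
Hypothesis diamE : forall x y : X, E x -> E y -> (mdist x y <= D)%R.
Variables (t W : R).
Hypotheses (t0 : (0 < t)%R) (t1 : (t < 1)%R) (W0 : (0 <= W)%R).
Hypotheses (W2_01 : W2 mu0 mu1 = W%:E) (W2_0t : W2 mu0 mut = (t * W)%:E)
  (W2_t1 : W2 mut mu1 = ((1 - t) * W)%:E).

(** In [displacement_glued], the main terms [t * W^2], [(1 - t) * W^2] and [W^2]
    cancel. One chooses [k] first, to make the term [2 L k] small, and then the
    defect of optimality and the size of the cells, both equal to [s], which get
    divided by [k]. The coupling does not depend on [G]. *)
Lemma near_optimal_displacement (L e : R) : (0 <= L)%R -> (0 < e)%R ->
  exists p, [/\ coupling mu0 mut p, cost p <= ((t * W) ^+ 2 + e)%:E &
    forall G : borel X -> R, measurable_fun setT G ->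
      (forall x, 0 <= G x <= L)%R ->
      \int[p]_z (G z.1 * mdist (z.1 : X) (z.2 : X))%:E <=
      (t * D)%:E * \int[mu0]_x (G x)%:E + e%:E].
Proof.
move=> L0 e0.
have t10 : (0 < 1 - t)%R by rewrite subr_gt0.
pose k := (e / (4 * (L + 1)))%R.
have k0 : (0 < k)%R by rewrite divr_gt0// mulr_gt0// ltr_wpDl.
have Lk : (2 * L * k <= e / 2)%R.
  rewrite /k mulrA ler_pdivrMr ?mulr_gt0 ?ltr_wpDl//; nra.
pose a0 := (L * (4 * k)^-1)%R.
have a00 : (0 <= a0)%R by rewrite mulr_ge0// invr_ge0 mulr_ge0// ltW.
pose B := (t^-1 + W ^+ 2 + 4 * (1 - t)^-1)%R.
have B0 : (0 < B)%R.
  by rewrite ltr_wpDl ?mulr_gt0 ?invr_gt0// addr_ge0 ?sqr_ge0// invr_ge0 ltW.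
have a10 : (0 < a0 + 1)%R by rewrite ltr_wpDl.
pose s := Num.min 1%R (Num.min e (e / (2 * (a0 + 1) * B)))%R.
have s0 : (0 < s)%R.
  by rewrite !lt_min ltr01 e0/= divr_gt0// !mulr_gt0.
have s1 : (s <= 1)%R by rewrite ge_min lexx.
have se : (s <= e)%R by rewrite !ge_min lexx orbT.
have sB : (a0 * B * s <= e / 2)%R.
  have : (s <= e / (2 * (a0 + 1) * B))%R by rewrite !ge_min lexx !orbT.
  rewrite ler_pdivlMr; last by rewrite !mulr_gt0.
  move=> h.
  have : (0 <= s * B)%R by rewrite mulr_ge0// ltW.
  nra.
have tW0 : (0 <= t * W)%R by rewrite mulr_ge0// ltW.
have tW1 : (0 <= (1 - t) * W)%R by rewrite mulr_ge0// ltW.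
have [p pc pW] := W2_near_optimal tW0 W2_0t s0.
have [q qc qW] := W2_near_optimal tW1 W2_t1 s0.
exists p; split => //; first by rewrite (le_trans pW)// lee_fin lerD2l.
move=> G mG GL.
have := displacement_glued sepX mE mu0E mu1E diamE t0 t1 W0 W2_01 pc qc s0 k0 L0 mG GL.
rewrite -leeBrDr// => /le_trans; apply.
set I := _ * \int[_]_x _; set cq := cost q + _.
rewrite leeBlDr// -!addeA leeD2l// -[in leRHS]EFinD.
have h1 : (L * (4 * k)^-1 * t^-1)%:E * cost p <=
    (a0 * t^-1 * ((t * W) ^+ 2 + s))%:E.
  by rewrite [leRHS]EFinM lee_wpmul2l// lee_fin mulr_ge0// invr_ge0 ltW.
have h2 : (L * (4 * k)^-1 * (1 - t)^-1 * (1 + s))%:E * cq <=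
    (a0 * (1 - t)^-1 * (1 + s) * (((1 - t) * W) ^+ 2 + s + s))%:E.
  rewrite [leRHS]EFinM lee_wpmul2l ?lee_fin//; last by rewrite [leRHS]EFinD leeD2r.
  by rewrite mulr_ge0 ?addr_ge0 ?(ltW s0)// mulr_ge0// invr_ge0 ltW.
apply: (le_trans (leeD2l _ (leeD h1 h2))).
rewrite -!EFinD lee_fin.
have -> : (a0 * t^-1 * ((t * W) ^+ 2 + s) = a0 * (t * W ^+ 2 + t^-1 * s))%R.
  by field; rewrite gt_eqF.
have -> : (a0 * (1 - t)^-1 * (1 + s) * (((1 - t) * W) ^+ 2 + s + s) =
  a0 * ((1 + s) * (1 - t) * W ^+ 2 + (1 - t)^-1 * (2 * s * (1 + s))))%R.
  by field; rewrite gt_eqF.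
suff main : (a0 * (t * W ^+ 2 + t^-1 * s) +
    a0 * ((1 + s) * (1 - t) * W ^+ 2 + (1 - t)^-1 * (2 * s * (1 + s)))
    <= a0 * W ^+ 2 + a0 * B * s)%R.
  by move: main Lk sB; rewrite -/a0; lra.
rewrite -[(a0 * B * s)%R]mulrA -!mulrDr ler_wpM2l//.
have h3 : ((1 - t)^-1 * (2 * s * (1 + s)) <= (1 - t)^-1 * (4 * s))%R.
  have ss : (s * s <= s)%R by rewrite ler_piMl// ltW.
  by rewrite ler_wpM2l ?invr_ge0 ?(ltW t10)//; lra.
have h4 : ((1 - t) * s * W ^+ 2 <= s * W ^+ 2)%R.
  by rewrite ler_wpM2r ?sqr_ge0// ler_piMl ?(ltW s0)// gerBl ltW.
rewrite /B; lra.
Qed.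

End displacement_near_optimal.

(** * Entropy, and measures carried by a bounded set *)

Section entropy.
Local Open Scope ereal_scope.
Context {R : realType} {X : completeMetricType R}.

(** The graph of [s * ln s] lies above its tangent at [r]. This is the source of
    the Gibbs inequality, and of the lower bound for the entropy on a set. *)
Lemma xlnx_tangent (s r : R) : (0 <= s)%R -> (0 < r)%R ->
  (ln r * s + s - r <= s * ln s)%R.
Proof.
rewrite le_eqVlt => /predU1P[<- r0|s0 r0]; first by rewrite mulr0 mul0r; lra.
have rs0 : (0 < r / s)%R by rewrite divr_gt0.
have : (ln (1 + (r / s - 1)) <= r / s - 1)%R by apply: le_ln1Dx; lra.
rewrite addrC subrK ln_div ?posrE// => h.
have : ((ln r - ln s) * s <= (r / s - 1) * s)%R by rewrite ler_wpM2r// ltW.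
rewrite [leRHS]mulrBl divfK ?gt_eqF//; lra.
Qed.

Section gibbs.
Variables (m : probability (borel X) R) (rho : borel X -> R) (c C : R).
Hypotheses (c0 : (0 < c)%R) (mrho : measurable_fun setT rho)
  (rhoc : forall x, (c <= rho x <= C)%R) (rho1 : \int[m]_x (rho x)%:E = 1).

Let rho_gt0 x : (0 < rho x)%R.
Proof. by have /andP[+ _] := rhoc x; exact: lt_le_trans. Qed.

Lemma measurable_ln_density : measurable_fun setT (fun x => ln (rho x)).
Proof. by apply: (measurableT_comp (@measurable_ln R)). Qed.

Lemma ln_density_bounded x : (`|ln (rho x)| <= `|ln c| + `|ln C|)%R.
Proof.
have /andP[cr rC] := rhoc x.
have h1 : (ln c <= ln (rho x))%R by rewrite ler_ln ?posrE.
have h2 : (ln (rho x) <= ln C)%R by rewrite ler_ln ?posrE// (lt_le_trans (rho_gt0 x)).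
have h3 := lerNnormlW (lexx `|ln c|%R).
have h4 := ler_norm (ln C); have h5 := normr_ge0 (ln c); have h6 := normr_ge0 (ln C).
by rewrite ler_norml; apply/andP; split; lra.
Qed.

(** Integrate [xlnx_tangent] at [r = rho x], for any density [s] of [mu]: the
    terms [s - rho] have integral [0]. *)
Lemma gibbs_inequality (mu : probability (borel X) R) :
  \int[mu]_x (ln (rho x))%:E <= Ent m mu.
Proof.
apply: le_ereal_inf_tmp => _ [s [ms s0 muE] <-].
have [lsi ->] := integral_density_bounded ms s0 muE
  measurable_ln_density ln_density_bounded.
have s1 : \int[m]_x (s x)%:E = 1.
  by rewrite -(muE _ measurableT) probability_setT.
have si : m.-integrable setT (EFin \o s).
  apply/integrableP; split; first exact/measurable_EFinP.
  by under eq_integral do rewrite gee0_abs ?lee_fin//; rewrite s1 ltry.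
have ri : m.-integrable setT (EFin \o rho).
  apply: (@bounded_integrable _ _ _ _ _ C) => // x.
  by rewrite gtr0_norm//; have /andP[] := rhoc x.
rewrite [leLHS](_ : _ = \int[m]_x ((ln (rho x) * s x) + s x - rho x)%:E); last first.
  under [RHS]eq_integral do rewrite EFinB EFinD.
  rewrite integralB//; last exact: integrableD.
  rewrite integralD//= s1 rho1 -addeA subee// adde0//.
apply: le_integral_measurable.
- by apply/measurable_EFinP; apply: measurable_funB => //; apply: measurable_funD => //;
    apply: measurable_funM => //; exact: measurable_ln_density.
- apply/measurable_EFinP; apply: measurable_funM => //.
  exact: (measurableT_comp (@measurable_ln R)).
- by move=> x; rewrite lee_fin xlnx_tangent.
Qed.

(** The Gibbs inequality for the measure [rho m] itself shows that the infimum
    that defines the entropy is attained at [rho]. *)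
Lemma Ent_density (mu : probability (borel X) R) : density m mu rho ->
  Ent m mu = \int[m]_x (ln (rho x) * rho x)%:E.
Proof.
move=> murho; have [_ rho0 muE] := murho.
have [_ <-] := integral_density_bounded mrho rho0 muE
  measurable_ln_density ln_density_bounded.
apply/eqP; rewrite eq_le gibbs_inequality andbT.
have [_ ->] := integral_density_bounded mrho rho0 muE
  measurable_ln_density ln_density_bounded.
under eq_integral do rewrite mulrC.
by apply: ereal_inf_lbound; exists rho.
Qed.

End gibbs.

Lemma Ent_self (m : probability (borel X) R) : Ent m m = 0.
Proof.
rewrite (@Ent_density m (cst 1%R) 1 1)//.
- by under eq_integral do rewrite /= ln1 mul0r; rewrite integral0.
- by move=> x /=; rewrite lexx.
- by rewrite /= integral_cst// mul1e; exact: probability_setT.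
- by split => // A mA; rewrite /= integral_cst// mul1e.
Qed.

End entropy.

Section bounded_support.
Local Open Scope ereal_scope.
Context {R : realType} {X : completeMetricType R}.
Hypothesis sepX : separable X.
Variables (E : set (borel X)) (D : R).
Hypotheses (mE : measurable E) (D0 : (0 <= D)%R).
Hypothesis diamE : forall x y : X, E x -> E y -> (mdist x y <= D)%R.
Implicit Types mu nu : probability (borel X) R.

Lemma ae_full_measure mu : mu E = 1 -> {ae mu, forall x, E x}.
Proof.
move=> muE; exists (~` E); split => //; first exact: measurableC.
by rewrite probability_setC// muE subee.
Qed.

Lemma bounded_support_second_moment mu (x0 : X) : E x0 -> mu E = 1 ->
  finite_second_moment mu.
Proof.
move=> Ex0 muE; exists x0.
apply: (@le_lt_trans _ _ (\int[mu]_x (D ^+ 2)%:E)); last first.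
  by rewrite integral_cst// [X in _ * X](probability_setT mu) mule1 ltry.
apply: ae_ge0_le_integral => //.
- by move=> x _; rewrite lee_fin sqr_ge0.
- apply/measurable_EFinP; apply: measurable_funX.
  under eq_fun do rewrite metric_sym; exact: measurable_mdistl.
- by move=> x _; rewrite lee_fin sqr_ge0.
- apply: filterS (ae_full_measure muE) => x Ex _.
  by rewrite lee_fin ler_pXn2r ?nnegrE ?mdist_ge0// diamE.
Qed.

(** The product coupling has cost at most [D ^+ 2]. *)
Lemma W2_le_diam mu nu : mu E = 1 -> nu E = 1 ->
  exists W : R, [/\ (0 <= W)%R, (W <= D)%R & W2 mu nu = W%:E].
Proof.
move=> muE nuE.
have pc : coupling mu nu (mu \x nu).
  move=> A mA; split.
    apply: (eq_trans (product_measure1E _ _ mA measurableT)).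
    by rewrite [X in _ * X](probability_setT nu) mule1.
  apply: (eq_trans (product_measure1E _ _ measurableT mA)).
  by rewrite [X in X * _](probability_setT mu) mul1e.
have costD : cost (mu \x nu) <= (D ^+ 2)%:E.
  apply: (@le_trans _ _ (\int[mu \x nu]_x (D ^+ 2)%:E)); last first.
    rewrite integral_cst// -[leRHS]mule1 lee_wpmul2l ?lee_fin ?sqr_ge0//.
    exact: probability_le1.
  apply: ae_ge0_le_integral => //.
  - by move=> x _; rewrite lee_fin sqr_ge0.
  - by apply/measurable_EFinP; apply: measurable_funX; exact: measurable_mdist.
  - by move=> x _; rewrite lee_fin sqr_ge0.
  have Exy : {ae mu \x nu, forall z, (E `*` E) z}.
    exists (~` (E `*` E)); split => //.
      by apply: measurableC; exact: measurableX.
    rewrite probability_setC; last exact: measurableX.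
    rewrite [X in _ - X](_ : _ = 1) ?subee//.
    apply: (eq_trans (product_measure1E _ _ mE mE)).
    by rewrite [X in X * _]muE [X in _ * X]nuE mule1.
  apply: filterS Exy => -[x y] /= [Ex Ey] _.
  by rewrite lee_fin ler_pXn2r ?nnegrE ?mdist_ge0// diamE.
rewrite /W2; set i := ereal_inf _.
have i0 : 0 <= i by apply: le_ereal_inf_tmp => _ [p _ <-]; exact: cost_ge0.
have iD : i <= (D ^+ 2)%:E.
  by apply: le_trans costD; apply: ereal_inf_lbound; exists (mu \x nu).
case: i i0 iD => [r| |]//= r0 rD.
exists (Num.sqrt r); split => //.
by rewrite -(ger0_norm D0) -sqrtr_sqr ler_sqrt ?sqr_ge0.
Qed.

End bounded_support.

(** * An HWI inequality with the L^1 norm of the gradient *)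

(** The first order term is divided by [a], the density at the starting point,
    so that integration against [mu_0] gives back the gradient of the density.
    This is the wrong side for the concavity of [ln], whence the quadratic
    term. *)
Lemma ln_diff_le (R : realType) (a b c : R) : 0 < c -> c <= a -> c <= b ->
  ln a - ln b <= (a - b) / a + (c ^+ 2)^-1 * (a - b) ^+ 2.
Proof.
move=> c0 ca cb.
have a0 : 0 < a by rewrite (lt_le_trans c0).
have b0 : 0 < b by rewrite (lt_le_trans c0).
have ab0 : 0 < a / b by rewrite divr_gt0.
have : ln (1 + (a / b - 1)) <= a / b - 1 by apply: le_ln1Dx; lra.
rewrite addrC subrK ln_div ?posrE// => /le_trans; apply.
have -> : a / b - 1 = (a - b) / a + (a * b)^-1 * (a - b) ^+ 2.
  by field; rewrite !gt_eqF.
rewrite lerD2l ler_wpM2r ?sqr_ge0// lef_pV2 ?posrE ?mulr_gt0 ?exprn_gt0//.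
by rewrite expr2 ler_pM// ltW.
Qed.

Section L1_HWI.
Local Open Scope ereal_scope.
Context {R : realType} {X : completeMetricType R}.
Hypothesis sepX : separable X.
Variables (m : probability (borel X) R) (K : R).
Hypothesis convex : Ent_convex m K.
Variables (E : set (borel X)) (D : R) (x0 : X).
Hypotheses (mE : measurable E) (D0 : (0 <= D)%R) (Ex0 : E x0) (m1E : m E = 1).
Hypothesis diamE : forall x y : X, E x -> E y -> (mdist x y <= D)%R.
Variables (rho : borel X -> R) (c C L r : R) (G : borel X -> R).
Hypotheses (c0 : (0 < c)%R) (mrho : measurable_fun setT rho)
  (rhoc : forall x, (c <= rho x <= C)%R) (rho1 : \int[m]_x (rho x)%:E = 1).
Hypothesis rhoL : forall x y : X, (`|rho x - rho y| <= L * mdist x y)%R.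
Hypotheses (r0 : (0 < r)%R) (mG : measurable_fun setT G)
  (GL : forall x, (0 <= G x <= L)%R).
Hypothesis rhoG : forall x y : X,
  (mdist x y < r)%R -> (`|rho x - rho y| <= G x * mdist x y)%R.

Let rho_gt0 x : (0 < rho x)%R.
Proof. by have /andP[+ _] := rhoc x; exact: lt_le_trans. Qed.
Let rho_ge0 x : (0 <= rho x)%R. Proof. exact: ltW. Qed.
Let L0 : (0 <= L)%R.
Proof. by have /andP[G0 /(le_trans G0)] := GL point. Qed.

Let phi (x : borel X) := ln (rho x).
Let mphi : measurable_fun setT phi := measurable_ln_density mrho.
Let B := (`|ln c| + `|ln C|)%R.
Let phiB x : (`|phi x| <= B)%R := ln_density_bounded c0 rhoc x.
Let C1 := (L / (r * c) + L ^+ 2 / c ^+ 2)%R.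
Let H := (\int[m]_x (phi x * rho x))%R.
Let I := (\int[m]_x G x)%R.

Let C10 : (0 <= C1)%R.
Proof. by rewrite addr_ge0// divr_ge0// ?sqr_ge0// mulr_ge0// ltW. Qed.

(** If [r <= d (x, y)], where the local constant [G] says nothing, the difference
    is quadratic in the distance: [L d <= (L / r) d^2]. *)
Let phi_diff (x y : X) :
  (phi x - phi y <= G x / rho x * mdist x y + C1 * mdist x y ^+ 2)%R.
Proof.
have /andP[cx _] := rhoc x; have /andP[cy _] := rhoc y.
have d0 := mdist_ge0 x y.
apply: (le_trans (ln_diff_le c0 cx cy)); rewrite /C1 [X in (_ <= _ + X)%R]mulrDl addrA lerD//.
  have [xyr|ryx] := ltP (mdist x y) r.
    have h : ((rho x - rho y) / rho x <= G x / rho x * mdist x y)%R.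
      rewrite mulrAC ler_pM2r ?invr_gt0// (le_trans (ler_norm _))//; exact: rhoG.
    by rewrite (le_trans h)// lerDl mulr_ge0 ?sqr_ge0// divr_ge0// mulr_ge0// ltW.
  have /andP[G0 _] := GL x.
  apply: (@le_trans _ _ (L / (r * c) * mdist x y ^+ 2))%R; last first.
    by rewrite lerDr mulr_ge0// divr_ge0.
  apply: (@le_trans _ _ (L * mdist x y / c))%R.
    apply: (@le_trans _ _ (L * mdist x y / rho x))%R.
      by rewrite ler_pM2r ?invr_gt0// (le_trans (ler_norm _)).
    by rewrite ler_wpM2l ?mulr_ge0// lef_pV2 ?posrE.
  rewrite (_ : L * mdist x y / c = L / (r * c) * (r * mdist x y))%R; last first.
    by field; rewrite !gt_eqF.
  have rc0 : (0 <= L / (r * c))%R by rewrite divr_ge0// mulr_ge0// ltW.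
  by rewrite expr2 ler_wpM2l// ler_wpM2r.
rewrite mulrC [leRHS]mulrAC; apply: ler_wpM2r; first by rewrite invr_ge0 sqr_ge0.
by rewrite -exprMn -(real_normK (num_real (rho x - rho y))) ler_pXn2r// nnegrE mulr_ge0.
Qed.

Let Gi : m.-integrable setT (EFin \o G).
Proof.
apply: (@bounded_integrable _ _ _ _ _ L) => // x.
by have /andP[G0 GxL] := GL x; rewrite ger0_norm.
Qed.

(** The terms in [C1], of second order in [t], disappear after division by [t]:
    the mean of [d^2] for a near optimal coupling of [mu_0] and [mu_t] is about
    [(t W)^2]. *)
Let step (t e : R) : (0 < t)%R -> (t < 1)%R -> (0 < e)%R ->
  (t * H <= t * D * I + e + C1 * ((t * D) ^+ 2 + e) + t * (`|K| / 2 * D ^+ 2))%R.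
Proof.
move=> t0 t1 e0.
have [mu0 mu0E] := density_probability mrho rho_ge0 rho1.
have dens0 : density m mu0 rho by split.
have mu0E1 : mu0 E = 1.
  have h : mu0 (~` E) = 0.
    rewrite mu0E; apply: null_set_integral; first exact: measurableC.
      by apply/measurable_EFinP; exact: measurable_funTS.
    by rewrite [LHS](probability_setC _ mE) [X in _ - X]m1E subee.
  rewrite -(setCK E) probability_setC; last exact: measurableC.
  by rewrite h sube0.
have [phii phimu0] := integral_density_bounded mrho rho_ge0 (fun A _ => mu0E A) mphi phiB.
have HE : \int[mu0]_x (phi x)%:E = H%:E by rewrite phimu0 EFin_Rintegral.
have EntH : Ent m mu0 = H%:E.
  by rewrite (Ent_density c0 mrho rhoc rho1 dens0) EFin_Rintegral.
have [W [W0 WD WE]] := W2_le_diam sepX mE D0 diamE mu0E1 m1E.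
have fsm0 := bounded_support_second_moment mE D0 diamE Ex0 mu0E1.
have fsm := bounded_support_second_moment mE D0 diamE Ex0 m1E.
have EntHf : Ent m mu0 \is a fin_num by rewrite EntH.
have Entmf : Ent m m \is a fin_num by rewrite Ent_self.
have [mu [mu01 _ muW] muEnt] := convex fsm0 fsm EntHf Entmf.
have t01 : (0 <= t <= 1)%R by rewrite !ltW.
pose A := (\int[mu t]_x phi x)%R.
have phiit : (mu t).-integrable setT (EFin \o phi) by exact: bounded_integrable phiB.
have phii0 : mu0.-integrable setT (EFin \o phi) by exact: bounded_integrable phiB.
(* Gibbs at time [t], and the convexity of the entropy. *)
have AE : (A <= (1 - t) * H + t * (`|K| / 2 * D ^+ 2))%R.
  have := le_trans (gibbs_inequality c0 mrho rhoc rho1 (mu t)) (muEnt t t01).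
  rewrite EntH Ent_self mule0 adde0 WE -EFin_expe -!EFinM -EFinB.
  rewrite EFin_Rintegral// lee_fin => /le_trans; apply.
  rewrite lerD2l -mulNr; have t1' : (0 <= 1 - t <= 1)%R by apply/andP; split; lra.
  have KW : (- K * W ^+ 2 <= `|K| * D ^+ 2)%R.
    apply: (@le_trans _ _ (`|K| * W ^+ 2)%R).
      by rewrite ler_wpM2r ?sqr_ge0// -normrN ler_norm.
    by rewrite ler_wpM2l// ler_pXn2r// nnegrE.
  have tt0 : (0 <= t * (1 - t))%R by rewrite mulr_ge0; [|lra..].
  have tt1 : (t * (1 - t) <= t)%R by rewrite ler_piMr; [|lra..].
  have := ler_wpM2l tt0 KW.
  have := ler_wpM2r (mulr_ge0 (normr_ge0 K) (sqr_ge0 D)) tt1.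
  lra.
have W2_0t : W2 mu0 (mu t) = (t * W)%:E.
  have -> : W2 mu0 (mu t) = W2 (mu 0%R) (mu t).
    rewrite /W2; congr (sqrte (ereal_inf _)); congr (image _ _).
    apply/seteqP; split=> q qc A' mA'; have [q1 q2] := qc _ mA'; split => //.
      by rewrite q1; exact/esym/(mu01 _ mA').1.
    by rewrite q1; exact: (mu01 _ mA').1.
  by rewrite muW ?lexx ?ler01// subr0 gtr0_norm// WE -EFinM.
have W2_t1 : W2 (mu t) m = ((1 - t) * W)%:E.
  have -> : W2 (mu t) m = W2 (mu t) (mu 1%R).
    rewrite /W2; congr (sqrte (ereal_inf _)); congr (image _ _).
    apply/seteqP; split=> q qc A' mA'; have [q1 q2] := qc _ mA'; split => //.
      by rewrite q2; exact/esym/(mu01 _ mA').2.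
    by rewrite q2; exact: (mu01 _ mA').2.
  by rewrite muW ?lexx ?ler01// gtr0_norm ?subr_gt0// WE -EFinM.
have Lc0 : (0 <= L / c)%R by rewrite divr_ge0// ltW.
have [p [pc pcost pG]] := near_optimal_displacement sepX mE mu0E1 m1E diamE t0 t1 W0
  WE W2_0t W2_t1 Lc0 e0.
pose G' x := (G x / rho x)%R.
have mG' : measurable_fun setT G'.
  apply: measurable_funM => //.
  have -> : (fun x => (rho x)^-1%R) = (fun x => expR (- phi x)).
    by apply/funext => x; rewrite expRN lnK ?posrE.
  by apply: (measurableT_comp (@measurable_expR R)); exact: measurable_funN.
have G'L x : (0 <= G' x <= L / c)%R.
  have /andP[G0 GxL] := GL x; have /andP[cr _] := rhoc x.
  rewrite divr_ge0//= ler_pM// ?invr_ge0// lef_pV2 ?posrE//.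
have G'I : \int[mu0]_x (G' x)%:E = I%:E.
  rewrite (integral_density mrho rho_ge0 (fun A _ => mu0E A)); last 2 first.
  - exact/measurable_EFinP.
  - by move=> x; rewrite lee_fin; have /andP[] := G'L x.
  rewrite /I -(EFin_Rintegral Gi); apply: eq_integral => x _.
  by rewrite -EFinM /G' divfK// gt_eqF.
have mphi1 : measurable_fun setT (fun z : borel X * borel X => phi z.1).
  exact: (measurableT_comp mphi).
have mphi2 : measurable_fun setT (fun z : borel X * borel X => phi z.2).
  exact: (measurableT_comp mphi).
have HA : (H - A)%:E = \int[p]_z (phi z.1 - phi z.2)%:E.
  under eq_integral do rewrite EFinB.
  rewrite integralB//; last 2 first.
  - exact: (bounded_integrable p mphi1 (fun z => phiB z.1)).
  - exact: (bounded_integrable p mphi2 (fun z => phiB z.2)).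
  rewrite (integral_fst_marginal_bounded (fun A mA => (pc A mA).1) mphi phiB) HE.
  rewrite (integral_snd_marginal_bounded (fun A mA => (pc A mA).2) mphi phiB).
  by rewrite EFin_Rintegral.
have md := measurable_mdist sepX.
have md2 : measurable_fun setT (fun z : borel X * borel X =>
    mdist (z.1 : X) (z.2 : X) ^+ 2)%R by exact: measurable_funX.
have mG'd : measurable_fun setT (fun z : borel X * borel X =>
    G' z.1 * mdist (z.1 : X) (z.2 : X))%R.
  by apply: measurable_funM => //; exact: (measurableT_comp mG').
have : (H - A)%:E <= (t * D * I + e + C1 * ((t * D) ^+ 2 + e))%:E.
  rewrite HA.
  apply: (@le_trans _ _ (\int[p]_z (G' z.1 * mdist (z.1 : X) (z.2 : X) +
      C1 * mdist (z.1 : X) (z.2 : X) ^+ 2)%:E)).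
    apply: le_integral_measurable.
    - by apply/measurable_EFinP; exact: measurable_funB.
    - by apply/measurable_EFinP; apply: measurable_funD => //; exact: measurable_funM.
    - by move=> z; rewrite lee_fin phi_diff.
  under eq_integral do rewrite EFinD.
  rewrite ge0_integralD//; last 4 first.
  - by move=> z _; rewrite lee_fin mulr_ge0 ?mdist_ge0//; have /andP[] := G'L z.1.
  - exact/measurable_EFinP.
  - by move=> z _; rewrite lee_fin mulr_ge0 ?sqr_ge0.
  - by apply/measurable_EFinP; exact: measurable_funM.
  rewrite EFinD leeD//.
    by rewrite EFinD EFinM -G'I; exact: pG.
  under eq_integral do rewrite EFinM.
  rewrite ge0_integralZl_EFin//; last 2 first.
  - by move=> z _; rewrite lee_fin sqr_ge0.
  - exact/measurable_EFinP.
  rewrite EFinM lee_wpmul2l ?lee_fin// (le_trans pcost)// lee_fin lerD2r.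
  by rewrite ler_pXn2r ?nnegrE ?mulr_ge0 ?(ltW t0)// ler_wpM2l// ltW.
rewrite lee_fin; lra.
Qed.

(** Take [e = t^2] in [step], divide by [t], and let [t] tend to [0]. *)
Lemma L1_HWI : \int[m]_x (ln (rho x) * rho x)%:E <=
  D%:E * \int[m]_x (G x)%:E + (`|K| / 2 * D ^+ 2)%:E.
Proof.
have [mu0 mu0E] := density_probability mrho rho_ge0 rho1.
have [phii _] := integral_density_bounded mrho rho_ge0 (fun A _ => mu0E A) mphi phiB.
rewrite (EFin_Rintegral phii) (EFin_Rintegral Gi) -EFinM -EFinD lee_fin -/H -/I.
apply/ler_addgt0Pl => e e0.
pose C2 := (1 + C1 * (D ^+ 2 + 1))%R.
have C20 : (0 < C2)%R by rewrite ltr_pwDl// mulr_ge0// addr_ge0// sqr_ge0.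
pose t := (Num.min 2^-1 (e / C2))%R.
have t0 : (0 < t)%R by rewrite lt_min invr_gt0 ltr0n/= divr_gt0.
have t1 : (t < 1)%R by rewrite gt_min; apply/orP; left; lra.
have te : (t * C2 <= e)%R by rewrite -ler_pdivlMr// ge_min lexx orbT.
have := step t0 t1 (mulr_gt0 t0 t0).
have -> : (t * D * I + t * t + C1 * ((t * D) ^+ 2 + t * t) + t * (`|K| / 2 * D ^+ 2) =
   t * (t * C2 + (D * I + `|K| / 2 * D ^+ 2)))%R by rewrite /C2; ring.
rewrite ler_pM2l// => /le_trans; apply.
by rewrite lerD2r.
Qed.

End L1_HWI.

(** * The support, and local Lipschitz constants *)

Section support.
Local Open Scope ereal_scope.
Context {R : realType} {X : completeMetricType R}.
Hypothesis sepX : separable X.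
Variable m : probability (borel X) R.
Local Notation E := (msupp m : set (borel X)).

Lemma notin_msupp (x : X) : ~ msupp m x -> exists2 r : R, (0 < r)%R & m (ball x r) = 0.
Proof.
move=> /existsNP[r /not_implyP[r0 /negP]]; rewrite -leNgt measure_le0 => /eqP mr.
by exists r.
Qed.

Lemma measurable_msupp : measurable E.
Proof.
rewrite -[X in measurable X]setCK; apply: measurableC; apply: open_borel.
apply: open_of_balls => x.
move=> /notin_msupp[r r0 mr]; exists r => // y xy /(_ (r - mdist x y)%R).
rewrite subr_gt0 => /(_ xy); apply/negP; rewrite -leNgt -mr le_measure ?inE//.
- exact: measurable_metric_ball.
- exact: measurable_metric_ball.
- move=> z; rewrite !ballEmdist/= => yz.
  by have := metric_triangle x y z; lra.
Qed.

(** The complement of the support is covered by the null balls whose centers are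
    in a dense sequence and whose radii are inverses of integers. *)
Lemma msupp_full : m E = 1.
Proof.
have [s sd] := dense_sequence sepX.
pose r (k : nat) : R := (k.+1%:R)^-1%R.
pose B n k : set (borel X) := if m (ball (s n) (r k)) == 0 then ball (s n) (r k) else set0.
have B0 n k : m.-negligible (B n k).
  rewrite /B; case: ifPn => [/eqP b0|_]; last exact: negligible_set0.
  by exists (ball (s n) (r k)); split => //; exact: measurable_metric_ball.
have mCE := measurableC measurable_msupp.
have : m.-negligible (~` E).
  apply: (negligibleS (A := \bigcup_n \bigcup_k B n k)); last first.
    by apply: negligible_bigcup => n; exact: negligible_bigcup.
  move=> x /notin_msupp[e e0 me].
  have [k ke] : exists k, (r k < e / 2)%R.
    exists (Num.truncn (2 / e)); rewrite /r -[(e / 2)%R]invrK invf_div.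
    by rewrite ltf_pV2 ?posrE ?divr_gt0// truncnS_gt.
  have rk0 : (0 < r k)%R by rewrite invr_gt0.
  have [n sn] := sd x (r k) rk0.
  exists n => //; exists k => //; rewrite /B ifT.
    by rewrite ballEmdist.
  rewrite -measure_le0 -me le_measure ?inE//; [exact: measurable_metric_ball..|].
  move=> y; rewrite !ballEmdist/= => sy.
  have := metric_triangle x (s n) y; rewrite (metric_sym x (s n)); lra.
move/(negligibleP _ mCE) => E0.
rewrite -(setCK E) probability_setC; last exact: mCE.
by rewrite [X in _ - X]E0 sube0.
Qed.

Lemma msupp_nonempty : exists x, E x.
Proof.
apply/set0P/eqP => E0; have := msupp_full; rewrite E0 measure0 => /eqP.
by rewrite eq_sym onee_eq0.
Qed.

Lemma mdist_le_diam (D : R) (x y : X) :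
  diam (msupp m) = D%:E -> E x -> E y -> (mdist x y <= D)%R.
Proof.
move=> DE Ex Ey; rewrite -lee_fin -DE; apply: ereal_sup_ubound.
by exists x, y.
Qed.

End support.

Section local_lipschitz.
Local Open Scope ereal_scope.
Context {R : realType} {X : completeMetricType R}.
Variables (u : X -> R) (L : R).
Hypotheses (uL : forall x y, (`|u x - u y| <= L * mdist x y)%R) (L0 : (0 <= L)%R).

Definition loc_lip (r : R) (x : X) : R := fine (lip_const u (ball x r)).

Lemma lip_const_le (A : set X) : lip_const u A <= L%:E.
Proof.
apply: ge_ereal_sup => _ [x [y [_ _ ->]]]; rewrite lee_fin.
have [d0|d0] := eqVneq (mdist x y) 0%R; first by rewrite d0 invr0 mulr0.
by rewrite ler_pdivrMr// lt_neqAle eq_sym d0 mdist_ge0.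
Qed.

Lemma lip_const_ge0 (A : set X) x : A x -> 0 <= lip_const u A.
Proof.
move=> Ax; apply: (le_trans _ (ereal_sup_ubound _)); last first.
  by exists x, x; split.
by rewrite lee_fin divr_ge0// mdist_ge0.
Qed.

Lemma loc_lipE (r : R) x : (0 < r)%R -> (loc_lip r x)%:E = lip_const u (ball x r).
Proof.
move=> r0; rewrite fineK// fin_numElt.
rewrite (lt_le_trans _ (lip_const_ge0 (ballxx x r0)))//= ?ltNy0//.
by rewrite (le_lt_trans (lip_const_le _))// ltry.
Qed.

Lemma loc_lip_bounds (r : R) x : (0 < r)%R -> (0 <= loc_lip r x <= L)%R.
Proof.
move=> r0; rewrite -!lee_fin loc_lipE// lip_const_le andbT.
exact: lip_const_ge0 (ballxx x r0).
Qed.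

Lemma loc_lip_diff (r : R) x y : (0 < r)%R -> (mdist x y < r)%R ->
  (`|u x - u y| <= loc_lip r x * mdist x y)%R.
Proof.
move=> r0 xyr; have [d0|d0] := eqVneq (mdist x y) 0%R.
  by rewrite (mdist_positivity _ _ d0) subrr normr0 mdistxx mulr0.
have d1 : (0 < mdist x y)%R by rewrite lt_neqAle eq_sym d0 mdist_ge0.
rewrite -ler_pdivrMr// -lee_fin loc_lipE//; apply: ereal_sup_ubound.
by exists x, y; split => //; [exact: ballxx|rewrite ballEmdist].
Qed.

(** A pair of points with a large difference quotient in the open ball
    [ball x r] is also in [ball x' r] for [x'] close to [x]. *)
Lemma measurable_loc_lip (r : R) : (0 < r)%R ->
  measurable_fun setT (loc_lip r : borel X -> R).
Proof.
move=> r0; apply: open_gt_measurable => a; apply: open_of_balls => x /=.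
rewrite -lte_fin loc_lipE// => /ereal_sup_gt[_ [y [z [+ + ->]]] ayz].
rewrite !ballEmdist/= => xy xz.
exists (Num.min (r - mdist x y) (r - mdist x z))%R.
  by rewrite lt_min !subr_gt0 xy.
move=> x'; rewrite lt_min => /andP[h1 h2].
rewrite -lte_fin loc_lipE//; apply: (lt_le_trans ayz).
apply: ereal_sup_ubound; exists y, z; rewrite !ballEmdist/=; split => //.
- have := metric_triangle x' x y; rewrite (metric_sym x' x); lra.
- have := metric_triangle x' x z; rewrite (metric_sym x' x); lra.
Qed.

(** The limit that defines [asym_lip] exists since [lip_const] is monotone in the
    radius; a sequence of radii is what dominated convergence asks for. *)
Lemma loc_lip_cvg x :
  (loc_lip (harmonic k) x)%:E @[k --> \oo] --> asym_lip u x.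
Proof.
pose F (r : R) := lip_const u (ball x r).
have ndF : {in Interval (BRight 0%R) (BInfty R false) &, nondecreasing_fun F}.
  move=> r r' _ _ rr'; apply: ereal_sup_le => _ [y [z [+ + ->]]].
  rewrite !ballEmdist => /= xy xz.
  by exists y, z; split => //; rewrite /= (lt_le_trans _ rr').
have cF := nondecreasing_at_right_cvge _ (isT : (BRight 0%R < BInfty R false)%O) ndF.
have -> : asym_lip u x = ereal_inf (F @` [set` Interval (BRight 0%R) (BInfty R false)]).
  by apply/cvg_lim => //; exact: cF.
have h0 : harmonic k @[k --> \oo] --> (0%R : R)^'+.
  move=> A [e /= e0 eA].
  have /cvgrPdist_lt/(_ e e0)[N _ hN] := @cvg_harmonic R.
  exists N => // k Nk; apply: eA; last exact: harmonic_gt0.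
  exact: (hN k Nk).
rewrite (_ : (fun k => _) = F \o harmonic); last first.
  by apply/funext => k; rewrite loc_lipE// harmonic_gt0.
exact: (cvg_comp _ _ h0 cF).
Qed.

Lemma asym_lip_bounds x : (0 <= asym_lip u x <= L%:E).
Proof.
have cu := @loc_lip_cvg x; rewrite -(cvg_lim _ cu)//.
have b k := loc_lip_bounds x (harmonic_gt0 k : (0 < harmonic k :> R)%R).
apply/andP; split.
- by apply: lime_ge (cvgP _ cu) _; apply: nearW => k; have /andP[] := b k.
- by apply: lime_le (cvgP _ cu) _; apply: nearW => k; have /andP[] := b k.
Qed.

End local_lipschitz.

(** * The truncated inequality for Lipschitz functions *)

Section lipschitz_inequality.
Local Open Scope ereal_scope.
Context {R : realType} {X : completeMetricType R}.
Hypothesis sepX : separable X.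
Variables (m : probability (borel X) R) (K D : R).
Hypotheses (convex : Ent_convex m K) (diamD : diam (msupp m) = D%:E).
Variables (u : X -> R) (L B c M : R) (A : set (borel X)).
Hypotheses (uL : forall x y, (`|u x - u y| <= L * mdist x y)%R) (L0 : (0 <= L)%R)
  (uB : forall x, (`|u x| <= B)%R).
Hypotheses (c0 : (0 < c)%R) (M1 : (1 <= M)%R) (mA : measurable A)
  (MA : (M * fine (m A) <= 1)%R).

(** The density to which [L1_HWI] is applied is [(v + c) / Z]; the constant [c]
    keeps it away from [0]. *)
Let v (x : borel X) : R := `|u x|%R.
Let kappa := (`|K| / 2 * D ^+ 2)%R.
Let Z := (\int[m]_x v x + c)%R.

Let mv : measurable_fun setT v.
Proof. by apply: (measurableT_comp (@normr_measurable R setT)); exact: lipschitz_measurable uL. Qed.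
Let v0 x : (0 <= v x)%R. Proof. exact: normr_ge0. Qed.
Let vi : m.-integrable setT (EFin \o v).
Proof.
apply: (@bounded_integrable _ _ _ _ _ B) => // x.
by rewrite ger0_norm// uB.
Qed.
Let B0 : (0 <= B)%R. Proof. exact: le_trans (normr_ge0 _) (uB point). Qed.
Let Z0 : (0 < Z)%R.
Proof. by rewrite ltr_wpDl// Rintegral_ge0. Qed.

Let vAi : m.-integrable setT (EFin \o (fun x => v x * \1_A x)%R).
Proof.
apply: (@bounded_integrable _ _ _ _ _ B).
  by apply: measurable_funM => //; exact: measurable_indic.
move=> x; rewrite normrM (ger0_norm (v0 x)) -[B]mulr1 ler_pM//.
  exact: uB.
by rewrite ger0_norm// indicE; case: (x \in A); rewrite ?ler01.
Qed.

Let DE : (0 <= D)%R.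
Proof.
have [x Ex] := msupp_nonempty sepX m.
exact: le_trans (mdist_ge0 x x) (mdist_le_diam diamD Ex Ex).
Qed.

(** [xlnx_tangent] at [r = M] on [A] and at [r = 1] elsewhere bounds the entropy
    below by [ln M * \int_A rho - (M - 1) * m A], where [M * m A <= 1]. *)
Lemma lipschitz_truncated_le (r : R) : (0 < r)%R ->
  (ln M * \int[m]_x (`|u x| * \1_A x) <=
   (1 + kappa) * Z + D * \int[m]_x loc_lip u r x)%R.
Proof.
move=> r0.
pose rho x := ((v x + c) / Z)%R.
pose G x := (loc_lip u r x / Z)%R.
have mrho : measurable_fun setT rho.
  by apply: measurable_funM => //; exact: measurable_funD.
have rhoc x : (c / Z <= rho x <= (B + c) / Z)%R.
  by rewrite !ler_pM2r ?invr_gt0// lerDr v0/= lerD2r uB.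
have rhoi : m.-integrable setT (EFin \o rho).
  apply: (@bounded_integrable _ _ _ _ _ ((B + c) / Z)) => // x.
  have /andP[cr] := rhoc x; rewrite ger0_norm//.
  by rewrite (le_trans _ cr)// divr_ge0// ltW.
have ci k : m.-integrable setT (EFin \o (cst k : borel X -> R)).
  exact: (@bounded_integrable _ _ _ _ _ `|k|%R).
have Rcst k : (\int[m]_x k = k)%R.
  by rewrite Rintegral_cst// [fine _](congr1 fine (probability_setT m)) mulr1.
have Rrho : (\int[m]_x rho x = 1)%R.
  rewrite /rho RintegralZr//; last exact: (integrableD measurableT vi (ci c)).
  by rewrite RintegralD// ?Rcst -/Z ?divff ?gt_eqF//; exact: ci.
have rho1 : \int[m]_x (rho x)%:E = 1 by rewrite EFin_Rintegral// Rrho.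
have cZ0 : (0 < c / Z)%R by rewrite divr_gt0.
have rhoL x y : (`|rho x - rho y| <= L / Z * mdist x y)%R.
  rewrite /rho -mulrBl normrM (gtr0_norm (x := Z^-1)) ?invr_gt0//.
  rewrite [leRHS]mulrAC ler_pM2r ?invr_gt0// opprD addrACA subrr addr0.
  by rewrite (le_trans (ler_dist_dist _ _)).
have mG : measurable_fun setT (G : borel X -> R).
  by apply: measurable_funM => //; exact: measurable_loc_lip uL L0 _ r0.
have GL x : (0 <= G x <= L / Z)%R.
  have /andP[g0 gL] := loc_lip_bounds uL L0 x r0.
  by rewrite divr_ge0 ?(ltW Z0)//= ler_pM2r ?invr_gt0.
have rhoG x y : (mdist x y < r)%R -> (`|rho x - rho y| <= G x * mdist x y)%R.
  move=> xyr; rewrite /rho -mulrBl normrM (gtr0_norm (x := Z^-1)) ?invr_gt0//.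
  rewrite [leRHS]mulrAC ler_pM2r ?invr_gt0// opprD addrACA subrr addr0.
  rewrite (le_trans (ler_dist_dist _ _))//; exact: (loc_lip_diff uL L0 r0 xyr).
have [x0 Ex0] := msupp_nonempty sepX m.
have hwi := L1_HWI sepX convex (measurable_msupp m) DE Ex0 (msupp_full sepX m)
  (fun x y => mdist_le_diam diamD) cZ0 mrho rhoc rho1 rhoL r0 mG GL rhoG.
have lrhoi : m.-integrable setT (EFin \o (fun x => ln (rho x) * rho x)%R).
  apply: (@bounded_integrable _ _ _ _ _
    ((`|ln (c / Z)| + `|ln ((B + c) / Z)|) * ((B + c) / Z))).
    by apply: measurable_funM => //; exact: measurable_ln_density.
  move=> x; rewrite normrM ler_pM//; first exact: ln_density_bounded cZ0 rhoc x.
  have /andP[cr] := rhoc x; rewrite ger0_norm//.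
  by rewrite (le_trans _ cr)// ltW.
have Gi : m.-integrable setT (EFin \o G).
  apply: (@bounded_integrable _ _ _ _ _ (L / Z)) => // x.
  by have /andP[g0 gL] := GL x; rewrite ger0_norm.
have li : m.-integrable setT (EFin \o loc_lip u r).
  apply: (@bounded_integrable _ _ _ _ _ L); first exact: measurable_loc_lip uL L0 _ r0.
  by move=> x; have /andP[g0 gL] := loc_lip_bounds uL L0 x r0; rewrite ger0_norm.
have GE : (\int[m]_x G x = (\int[m]_x loc_lip u r x) / Z)%R by rewrite RintegralZr.
have Ai : m.-integrable setT (EFin \o (\1_A : borel X -> R)).
  apply: (@bounded_integrable _ _ _ _ _ 1%R); first exact: measurable_indic.
  by move=> x; rewrite ger0_norm// indicE; case: (x \in A); rewrite ?ler01.
have AE : (\int[m]_x \1_A x = fine (m A))%R.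
  by rewrite /Rintegral integral_indic// setIT.
have rAi : m.-integrable setT (EFin \o (fun x => rho x * \1_A x)%R).
  apply: (le_integrable measurableT _ _ rhoi).
    by apply/measurable_EFinP; apply: measurable_funM => //; exact: measurable_indic.
  move=> x _ /=; rewrite lee_fin normrM -[leRHS]mulr1 ler_wpM2l//.
  by rewrite ger0_norm// indicE; case: (x \in A); rewrite ?ler01.
have rhoA : ((\int[m]_x (`|u x| * \1_A x)) / Z <= \int[m]_x (rho x * \1_A x))%R.
  rewrite -RintegralZr//; apply: le_Rintegral => //.
    exact: (integrableZr measurableT Z^-1 vAi).
  move=> x _; rewrite mulrAC ler_wpM2r// ler_pM2r ?invr_gt0//.
  by rewrite lerDl ltW.
have i1 : m.-integrable setT (EFin \o (fun x => ln M * (rho x * \1_A x))%R).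
  exact: (integrableZl measurableT (ln M) rAi).
have i3 := integrableZl measurableT (M - 1)%R Ai.
have i2 : m.-integrable setT (EFin \o (fun x => 1 + (M - 1) * \1_A x)%R).
  exact: (integrableD measurableT (ci 1%R) i3).
have low : (ln M * \int[m]_x (rho x * \1_A x) - 1 <= \int[m]_x (ln (rho x) * rho x))%R.
  apply: (@le_trans _ _ (\int[m]_x (ln M * (rho x * \1_A x) +
      (rho x - (1 + (M - 1) * \1_A x)))))%R.
    rewrite RintegralD//; last exact: (integrableB measurableT rhoi i2).
    rewrite RintegralZl// RintegralB// Rrho RintegralD//; last exact: ci.
    rewrite Rcst RintegralZl// AE lerD2l.
    have := fine_ge0 (measure_ge0 m A); move: MA; lra.
  apply: le_Rintegral => //.
    exact: (integrableD measurableT i1 (integrableB measurableT rhoi i2)).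
  move=> x _; rewrite [leRHS]mulrC.
  have rx0 : (0 < rho x)%R by have /andP[h _] := rhoc x; exact: lt_le_trans h.
  rewrite indicE; case: (x \in A); rewrite ?mulr1n ?mulr0n ?mulr1 ?mulr0.
    have := xlnx_tangent (ltW rx0) (lt_le_trans ltr01 M1); lra.
  by have := xlnx_tangent (ltW rx0) (@ltr01 R); rewrite ln1; lra.
have lnM0 : (0 <= ln M)%R by rewrite ln_ge0.
move: hwi; rewrite (EFin_Rintegral lrhoi) (EFin_Rintegral Gi) -EFinM -EFinD lee_fin GE.
move=> /(le_trans low); rewrite -/kappa => h.
have h2 : (ln M * (\int[m]_x (`|u x| * \1_A x) / Z) <=
    1 + kappa + D * (\int[m]_x loc_lip u r x / Z))%R.
  by have := ler_wpM2l lnM0 rhoA; lra.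
rewrite -(ler_pM2r (x := Z^-1%R)) ?invr_gt0// mulrDl mulfK ?gt_eqF//.
by rewrite -(mulrA (ln M)) -(mulrA D).
Qed.

Hypothesis masym : measurable_fun setT (fun x : borel X => fine (asym_lip u x)).

Lemma asym_lip_truncated_le :
  (ln M * \int[m]_x (`|u x| * \1_A x) <=
   (1 + kappa) * Z + D * \int[m]_x fine (asym_lip u x))%R.
Proof.
have cvgI : (\int[m]_x loc_lip u (harmonic k) x @[k --> \oo] -->
    \int[m]_x fine (asym_lip u x))%R.
  apply: fine_cvg.
  have fa x : asym_lip u x \is a fin_num.
    have /andP[a0 aL] := asym_lip_bounds uL L0 x.
    by rewrite ge0_fin_numE// (le_lt_trans aL)// ltry.
  have ai : m.-integrable setT (fun x : borel X => (fine (asym_lip u x))%:E).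
    apply: (@bounded_integrable _ _ _ _ _ L masym) => x.
    have /andP[a0 aL] := asym_lip_bounds uL L0 x.
    by rewrite ger0_norm ?fine_ge0// -lee_fin fineK.
  rewrite -EFin_Rintegral//.
  have ci : m.-integrable setT (EFin \o (cst L : borel X -> R)).
    exact: (@bounded_integrable _ _ _ _ _ `|L|%R).
  have [] // := @dominated_convergence _ _ R m setT measurableT
    (fun k x => (loc_lip u (harmonic k) x)%:E) (fun x => (fine (asym_lip u x))%:E)
    (EFin \o cst L) _ _ _ ci _.
  - move=> k; apply/measurable_EFinP.
    exact: measurable_loc_lip uL L0 _ (harmonic_gt0 k).
  - exact/measurable_EFinP.
  - by apply: aeW => x _; rewrite (fineK (fa x)); exact: (@loc_lip_cvg _ _ u L uL L0 x).
  - apply: aeW => x k _ /=; rewrite lee_fin.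
    by have /andP[g0 gL] := loc_lip_bounds uL L0 x (harmonic_gt0 k); rewrite ger0_norm.
have cv : ((1 + kappa) * Z + D * \int[m]_x loc_lip u (harmonic k) x)%R @[k --> \oo] -->
    ((1 + kappa) * Z + D * \int[m]_x fine (asym_lip u x))%R.
  by apply: cvgD; [exact: cvg_cst|apply: cvgM; [exact: cvg_cst|exact: cvgI]].
rewrite -(cvg_lim _ cv)//; apply: limr_ge; first exact: cvgP cv.
apply: nearW => k; exact: lipschitz_truncated_le (harmonic_gt0 k).
Qed.

End lipschitz_inequality.

(** * Relaxation *)

Section L2_facts.
Local Open Scope ereal_scope.
Context {d} {T : measurableType d} {R : realType} (P : probability T R).

(** The inequality of Hoelder with the constant [1], as [P] has total mass [1]. *)
Lemma Lnorm1_le_Lnorm2 (w : T -> R) : measurable_fun setT w ->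
  \int[P]_x (`|w x|)%:E <= 'N[P]_2%:E[EFin \o w].
Proof.
move=> mw; have half : (2^-1 + 2^-1 = 1 :> R)%R by rewrite -[2^-1%R]mul1r -splitr.
have := @hoelder _ _ _ P w (cst 1%R) 2 2 mw (measurable_cst _) (ltr0n _ 2) (ltr0n _ 2) half.
rewrite Lnorm1 [X in _ <= _ * X](Lnorm_cst1 P 2) [X in X `^ _](probability_setT P).
rewrite poweR1r mule1; apply: le_trans; rewrite le_eqVlt; apply/orP; left; apply/eqP; apply: eq_integral => x _.
by rewrite /= mulr1.
Qed.


Lemma L2_integrable (w : T -> R) : w \in Lfun P 2%:E -> P.-integrable setT (EFin \o w).
Proof.
move=> w2; apply/Lfun1_integrable; apply: Lfun_subset12 => //.
exact: fin_num_measure.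
Qed.

End L2_facts.

Theorem proposition4p7 (R : realType) (K D eps : R) (eps_gt0 : 0 < eps) :
  exists2 M : R, 1 <= M &
    forall (X : completeMetricType R) (m : {measure set (borel X) -> \bar R}),
      RCD m K -> m setT = 1%E -> diam (msupp m) = D%:E ->
      forall f : X -> R, Lip_b f -> (forall x, 0 <= f x) ->
      forall g : X -> R, min_relaxed_slope m f g ->
      (\int[m]_(x in [set x | M%:E * \int[m]_y (f y)%:E <= (f x)%:E]) (f x)%:E
         <= eps%:E * (\int[m]_x (f x)%:E + \int[m]_x (g x)%:E))%E.
Proof.
pose kappa := `|K| / 2 * D ^+ 2.
have kappa0 : 0 <= kappa by rewrite mulr_ge0 ?sqr_ge0// divr_ge0.
(* [b] is to dominate both coefficients in [lim_ineq] below. *)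
pose b := Num.max D (2 * (kappa + 1)).
have bD : D <= b by rewrite le_max lexx.
have bk : 2 * (kappa + 1) <= b by rewrite le_max lexx orbT.
have b0 : 0 < b by lra.
exists (expR (b / eps)); first by rewrite -expR0 ler_expR divr_ge0// ltW.
set M := expR _.
have M1 : 1 <= M by rewrite -expR0 ler_expR divr_ge0// ltW.
have lnM : ln M = b / eps by rewrite expRK.
move=> X m [[sepX _] _ _ convex] m1 diamD f [[Lf fL] [Cf fC]] f0 g.
move=> [[g2 [u [h [[uLip ucvg] G2 h2 wcvg hg]]]] _].
have [P Pm] := measure_as_probability m1.
subst m.
have mf : measurable_fun setT (f : borel X -> R) by exact: lipschitz_measurable fL.
have fi : P.-integrable setT (EFin \o (f : borel X -> R)).
  exact: bounded_integrable mf fC.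
have gi := L2_integrable g2.
have hi := L2_integrable h2.
pose c := \int[P]_x f x.
have fE : (\int[P]_x (f x)%:E = c%:E)%E by exact: EFin_Rintegral.
have gE : (\int[P]_x (g x)%:E = (\int[P]_x g x)%:E)%E by exact: EFin_Rintegral.
pose G n (x : borel X) := fine (asym_lip (u n) x).
have Gi n : P.-integrable setT (EFin \o G n) by exact: L2_integrable (G2 n).
have uLB n : exists L B : R, [/\ 0 <= L,
    forall x y, `|u n x - u n y| <= L * mdist x y & forall x, `|u n x| <= B].
  have [[[L uL] [B uB]] _] := uLip n; exists `|L|, B; split => // x y.
  by rewrite (le_trans (uL x y))// ler_wpM2r ?mdist_ge0// ler_norm.
have mu_ n : measurable_fun setT (u n : borel X -> R).
  by have [L [B [_ uL _]]] := uLB n; exact: lipschitz_measurable uL.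
have G0 n x : 0 <= G n x.
  have [L [B [L0 uL _]]] := uLB n.
  by have /andP[a0 _] := asym_lip_bounds uL L0 x; exact: fine_ge0.
have GI : (\int[P]_x G n x)%R @[n --> \oo] --> (\int[P]_x h x)%R.
  have one2 : L2 P (cst 1 : X -> R) by exact: Lfun_cst.
  have := wcvg _ one2.
  have -> : (\int[P]_x (h x * cst 1 x)%:E = (\int[P]_x h x)%:E)%E.
    by rewrite -(EFin_Rintegral hi); apply: eq_integral => x _; rewrite mulr1.
  rewrite (_ : (fun n => _) = fun n => ((\int[P]_x G n x)%R)%:E); last first.
    apply/funext => n; rewrite -(EFin_Rintegral (Gi n)).
    by apply: eq_integral => x _; rewrite mulr1.
  by move/fine_cvg.
have h_ge0 : 0 <= \int[P]_x h x.
  rewrite -(cvg_lim _ GI)//; apply: limr_ge; first exact: cvgP GI.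
  by apply: nearW => n; apply: Rintegral_ge0 => x _.
have hg_le : \int[P]_x h x <= \int[P]_x g x.
  have mh : measurable_fun setT (h : borel X -> R) by apply/measurable_EFinP; exact: measurable_int hi.
  have mg : measurable_fun setT (g : borel X -> R) by apply/measurable_EFinP; exact: measurable_int gi.
  have mhg : measurable_fun setT (fun x : borel X => Num.min (h x) (g x)).
    exact: measurable_minr.
  rewrite -lee_fin -(EFin_Rintegral hi) -(EFin_Rintegral gi).
  (* [Num.min h g] is a version of [h] that lies below [g] everywhere. *)
  rewrite (ae_eq_integral (fun x : borel X => (Num.min (h x) (g x))%:E))//; last 3 first.
  - exact: measurable_int hi.
  - exact/measurable_EFinP.
  - have [N [mN N0 hN]] := hg; exists N; split => // x xn.
    by apply: hN => hgx; apply: xn => _; rewrite /= min_l.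
  apply: le_integral_measurable; first exact/measurable_EFinP.
    exact: measurable_int gi.
  by move=> x; rewrite lee_fin ge_min lexx orbT.
pose A : set (borel X) := [set x | M * c <= f x].
have -> : [set x | (M%:E * \int[P]_y (f y)%:E <= (f x)%:E)%E] = A.
  by apply/seteqP; split=> x /=; rewrite fE -EFinM lee_fin.
have mA : measurable A.
  have := mf measurableT _ (measurable_itv `[(M * c), +oo[).
  by rewrite setTI preimage_itvcy.
pose FA := \int[P]_x (f x * \1_A x).
have fAi : P.-integrable setT (EFin \o (fun x => f x * \1_A x)).
  apply: (@bounded_integrable _ _ _ _ _ Cf).
    by apply: measurable_funM => //; exact: measurable_indic.
  move=> x; rewrite normrM -[Cf]mulr1 ler_pM//.
  by rewrite ger0_norm// indicE; case: (x \in A); rewrite ?ler01.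
have -> : (\int[P]_(x in A) (f x)%:E = FA%:E)%E.
  rewrite -(EFin_Rintegral fAi) integral_mkcond; apply: eq_integral => x _.
  by rewrite patchE indicE; case: (x \in A); rewrite ?mulr1 ?mulr0.
have Ai : P.-integrable setT (EFin \o (\1_A : borel X -> R)).
  apply: (@bounded_integrable _ _ _ _ _ 1); first exact: measurable_indic.
  by move=> x; rewrite ger0_norm// indicE; case: (x \in A); rewrite ?ler01.
have AE : \int[P]_x \1_A x = fine (P A).
  by rewrite /Rintegral integral_indic// setIT.
rewrite fE gE -EFinD -EFinM lee_fin.
have FAc : FA <= c.
  apply: le_Rintegral => // x _.
  by rewrite ler_piMr.
have c_ge0 : 0 <= c by apply: Rintegral_ge0.
(* [c] is the constant that is added to [`|u n|], so it has to be positive. *)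
have [c0|c0] := eqVneq c 0.
  by rewrite (le_trans FAc)// c0 add0r mulr_ge0 ?(ltW eps_gt0)// (le_trans h_ge0).
have c_gt0 : 0 < c by rewrite lt_neqAle eq_sym c0.
have MA : M * fine (P A) <= 1.
  rewrite -(ler_pM2r c_gt0) mul1r mulrAC -AE -RintegralZl//.
  apply: le_Rintegral => //; first exact: (integrableZl measurableT (M * c) Ai).
  move=> x _; rewrite indicE; have [/set_mem xA|xA] := boolP (x \in A).
    by rewrite mulr1.
  by rewrite mulr0.
pose delta n := \int[P]_x `|u n x - f x|.
have ui n : P.-integrable setT (EFin \o (u n : borel X -> R)).
  by have [L [B [_ _ uB]]] := uLB n; exact: bounded_integrable (mu_ n) uB.
have ufi n : P.-integrable setT (EFin \o (fun x => `|u n x - f x|)).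
  exact: (integrable_norm (integrableB measurableT (ui n) fi)).
have delta0 : delta n @[n --> \oo] --> (0 : R).
  suff : ((delta n)%:E @[n --> \oo] --> 0%E) by move/fine_cvg.
  apply: (squeeze_cvge _ (cvg_cst 0%E) ucvg); apply: nearW => n; apply/andP; split.
    by rewrite lee_fin Rintegral_ge0.
  rewrite -(EFin_Rintegral (ufi n)); apply: Lnorm1_le_Lnorm2.
  exact: measurable_funB.
have ineq n : ln M * (FA - delta n) <=
    (1 + kappa) * (2 * c + delta n) + D * \int[P]_x G n x.
  have [L [B [L0 uL uB]]] := uLB n.
  have mGn : measurable_fun setT (G n) by apply/measurable_EFinP; exact: measurable_int (Gi n).
  have := asym_lip_truncated_le sepX convex diamD uL L0 uB c_gt0 M1 mA MA mGn.
  rewrite -/kappa => main.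
  have dist x : (`|u n x| - f x <= `|u n x - f x|) && (f x - `|u n x| <= `|u n x - f x|).
    have := lerB_dist (u n x) (f x); have := lerB_dist (f x) (u n x).
    by rewrite (ger0_norm (f0 x)) distrC => -> ->.
  have uni : P.-integrable setT (EFin \o (fun x : borel X => `|u n x|)).
    exact: (integrable_norm (ui n)).
  have uAi : P.-integrable setT (EFin \o (fun x : borel X => `|u n x| * \1_A x)).
    apply: (@bounded_integrable _ _ _ _ _ B).
      apply: measurable_funM; last exact: measurable_indic.
      by apply/measurable_EFinP; exact: measurable_int uni.
    move=> x; rewrite normrM normr_id -[B]mulr1 ler_pM//.
    by rewrite ger0_norm// indicE; case: (x \in A); rewrite ?ler01.
  have unA : FA - delta n <= \int[P]_x (`|u n x| * \1_A x).
    rewrite lerBlDr -lerBlDl -RintegralB//; apply: le_Rintegral => //.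
      exact: (integrableB measurableT fAi uAi).
    move=> x _; have := dist x; rewrite indicE; case: (x \in A).
      by rewrite !mulr1 => /andP[_ ?]; lra.
    by rewrite !mulr0 subr0.
  have un : \int[P]_x `|u n x| <= c + delta n.
    rewrite -RintegralD//; apply: le_Rintegral => //.
      exact: (integrableD measurableT fi (ufi n)).
    by move=> x _; have /andP[? _] := dist x; lra.
  have lnM0 : 0 <= ln M by rewrite ln_ge0.
  rewrite (le_trans (ler_wpM2l lnM0 unA))// (le_trans main)// lerD2r.
  rewrite ler_wpM2l ?addr_ge0//; move: un; lra.
have lim_ineq : ln M * FA <= (1 + kappa) * (2 * c) + D * \int[P]_x h x.
  have cl : ln M * (FA - delta n) @[n --> \oo] --> ln M * FA.
    rewrite -{2}[FA]subr0.
    by apply: cvgM; [exact: cvg_cst|apply: cvgB; [exact: cvg_cst|exact: delta0]].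
  have cr : (1 + kappa) * (2 * c + delta n) + D * \int[P]_x G n x @[n --> \oo] -->
      (1 + kappa) * (2 * c) + D * \int[P]_x h x.
    rewrite -{2}[2 * c]addr0; apply: cvgD; apply: cvgM => //; try exact: cvg_cst.
    by apply: cvgD => //; exact: cvg_cst.
  by apply: (ler_cvg_to cl cr); apply: nearW.
have D0 : 0 <= D.
  have [x Ex] := msupp_nonempty sepX P.
  exact: le_trans (mdist_ge0 x x) (mdist_le_diam diamD Ex Ex).
rewrite -(ler_pM2l (divr_gt0 b0 eps_gt0)) -{1}lnM (le_trans lim_ineq)//.
rewrite mulrA divfK ?gt_eqF//.
have := ler_wpM2l D0 hg_le.
have := ler_wpM2r (le_trans h_ge0 hg_le) bD.
have := ler_wpM2r c_ge0 bk.
lra.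
Qed.
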